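(* Let $n>1$ and let $X$ be a finite pure $n$-dimensional weighted simplicial complex such that all the links of $X$ of dimension $>0$ (including $X=X_\emptyset$) are connected. Let $f(x) = 2-\frac{1}{x}$ and let $f^j$ be the composition of $f$ with itself $j$ times (where $f^0 (x) = x$). If there are $\kappa \geq \lambda > \frac{n-1}{n}$ such that $$\bigcup_{\tau \in \Sigma (n-2)} \mathrm{Spec} (\Delta_{\tau, 0}^+) \setminus \lbrace 0 \rbrace \subseteq [\lambda, \kappa],$$ then for every $0 \leq k \leq n-1$: $$ \mathrm{Spec} (\Delta_{k}^+) \setminus \lbrace 0 \rbrace \subseteq [(k+1 ) f^{n-1-k} (\lambda) - k,\ (k+1) f^{n-1-k} (\kappa)- k], $$ $$\mathrm{Spec} (\Delta_{k+1}^-) \setminus \lbrace 0 \rbrace \subseteq [(k+1 ) f^{n-1-k} (\lambda) - k,\ (k+1) f^{n-1-k} (\kappa)- k] .$$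
   Context: $X$ is pure $n$-dimensional if every simplex is a face of an $n$-simplex. $X^{(k)}$ is the set of $k$-simplices and $\Sigma(k)$ the set of ordered $k$-simplices ($(k+1)$-tuples of vertices forming a $k$-simplex), $-1\le k\le n$, with $X^{(-1)}=\Sigma(-1)=\{\emptyset\}$. Weighted means equipped with a balanced weight function: a function $m:\bigcup_{-1\le k\le n}X^{(k)}\to(0,\infty)$ with $\sum_{\sigma\in X^{(k+1)},\tau\subset\sigma}m(\sigma)=m(\tau)$ for all $-1\le k\le n-1$, $\tau\in X^{(k)}$. It is extended to ordered simplices by forgetting the order. $C^k(X,\mathbb R)$ is the space of antisymmetric functions $\Sigma(k)\to\mathbb R$ with inner product $\langle\phi,\psi\rangle=\sum_{\tau\in\Sigma(k)}\frac{m(\tau)}{(k+1)!}\phi(\tau)\psi(\tau)$. The differential $d_k:C^k\to C^{k+1}$ is $(d_k\phi)((v_0,\dots,v_{k+1}))=\sum_{i}(-1)^i\phi((v_0,\dots,\widehat{v_i},\dots,v_{k+1}))$ for $-1\le k\le n-1$, $\delta_k:C^{k+1}\to C^k$ is its adjoint, and $\Delta_k^+=\delta_kd_k$, $\Delta_k^-=d_{k-1}\delta_{k-1}$ on $C^k(X,\mathbb R)$. For $\tau\in\Sigma(j)$, the link $X_\tau$ is the complex of simplices $\sigma$ disjoint from $\tau$ with $\tau\cup\sigma$ a simplex of $X$; it is pure of dimension $n-j-1$, $X_\emptyset=X$, and it carries the balanced weight $m_\tau(\sigma)=m(\tau\sigma)$ ($\tau\sigma$ the concatenation). $\Delta^{\pm}_{\tau,k}$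 denote the operators $\Delta_k^\pm$ defined for $(X_\tau,m_\tau)$. $\mathrm{Spec}$ denotes the spectrum. *)

(* Defs.v *)
From HB Require Import structures.
From mathcomp Require Import all_boot all_order all_fingroup all_algebra.
From mathcomp Require Import boolp classical_sets set_interval reals.

Set Implicit Arguments.
Unset Strict Implicit.
Unset Printing Implicit Defensive.

Import Order.TTheory GRing.Theory Num.Theory.
Local Open Scope ring_scope.

(* Simplices are finite sets of vertices, the empty simplex (dimension -1)
   included, so that a k-simplex is a set of cardinal k + 1.  The vertices of
   X are the v with [set v] \in X; other elements of V play no role. *)

Section Complexes.
Variable V : finType.
Implicit Types (X : {set {set V}}) (s t : {set V}).

Definition is_complex X : Prop :=
  finset.set0 \in X /\ (forall s t, t \in X -> s \subset t -> s \in X).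

Definition pure (n : nat) X : Prop :=
  forall s, s \in X -> exists t, [/\ t \in X, s \subset t & #|t| = n.+1].

(* Truncated: the complex {set0} has dimension 0 here instead of -1. *)
Definition complex_dim X : nat := (\max_(s in X) #|s|).-1.

Definition edge X : rel V := [rel u v | (u != v) && ([set u; v]%SET \in X)].

Definition connected X : Prop :=
  forall u v : V, [set u]%SET \in X -> [set v]%SET \in X -> connect (edge X) u v.

Definition link X t : {set {set V}} :=
  [set s in X | [disjoint s & t] && (s :|: t \in X)]%SET.

Definition supp (p : nat) (t : p.-tuple V) : {set V} := [set x in t]%SET.

(* Sigma(p - 1): ordered simplices are indexed by their number p of vertices. *)
Definition ordered_simplex X (p : nat) : pred (p.-tuple V) :=
  fun t : p.-tuple V => uniq t && (supp t \in X).

Definition face (p : nat) (i : 'I_p.+1) (t : p.+1.-tuple V) : p.-tuple V :=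
  [tuple tnth t (lift i j) | j < p].

Definition permute (p : nat) (g : 'S_p) (t : p.-tuple V) : p.-tuple V :=
  [tuple tnth t (g j) | j < p].

Lemma ordered_simplex_face X p (i : 'I_p.+1) (t : p.+1.-tuple V) :
  is_complex X -> ordered_simplex X t -> ordered_simplex X (face i t).
Proof.
move=> [_ Xd] /andP[/tuple_uniqP ut Xt]; apply/andP; split.
  apply/tuple_uniqP=> a b; rewrite !tnth_mktuple => /ut; exact: lift_inj.
apply: Xd Xt _; apply/fintype.subsetP=> x; rewrite !inE => /tnthP[j ->].
by rewrite tnth_mktuple mem_tnth.
Qed.

Lemma supp_permute p (g : 'S_p) (t : p.-tuple V) : supp (permute g t) = supp t.
Proof.
apply/setP=> x; rewrite !inE; apply/tnthP/tnthP=> -[j ->].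
  by rewrite tnth_mktuple; exists (g j).
by exists (g^-1%g j); rewrite tnth_mktuple permKV.
Qed.

Lemma ordered_simplex_permute X p (g : 'S_p) (t : p.-tuple V) :
  ordered_simplex X (permute g t) = ordered_simplex X t.
Proof.
rewrite /ordered_simplex supp_permute; congr (_ && _).
apply/tuple_uniqP/tuple_uniqP=> ut a b.
  move=> e; apply: (can_inj (permKV g)); apply: ut.
  by rewrite !tnth_mktuple !permKV.
by rewrite !tnth_mktuple => /ut /perm_inj.
Qed.

Lemma face_permute p (g : 'S_p.+1) (i : 'I_p.+1) :
  exists h : 'S_p, odd_perm g = odd i (+) odd (g i) (+) odd_perm h /\
    forall t : p.+1.-tuple V, face i (permute g t) = permute h (face (g i) t).
Proof.
pose f (j : 'I_p) : 'I_p := odflt j (unlift (g i) (g (lift i j))).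
have fE j : lift (g i) (f j) = g (lift i j).
  rewrite /f; case: unliftP => [k -> //|/perm_inj e].
  by have := neq_lift i j; rewrite e eqxx.
have finj : injective f.
  by move=> a b /(congr1 (lift (g i))); rewrite !fE => /perm_inj; apply: lift_inj.
exists (perm finj); split; last first.
  by move=> t; apply: eq_from_tnth=> j; rewrite !tnth_mktuple permE fE.
rewrite -odd_lift_perm; congr odd_perm; apply/permP=> j.
case: (unliftP i j) => [k ->|->]; last by rewrite lift_perm_id.
by rewrite lift_perm_lift permE fE.
Qed.

End Complexes.

Section Weights.
Variables (R : realType) (V : finType).
Implicit Types (X : {set {set V}}) (m : {set V} -> R).

(* Only the values of m on X matter. *)
Definition balanced_weight (n : nat) X m : Prop :=
  (forall s, s \in X -> 0 < m s) /\
  (forall t, t \in X -> (#|t| <= n)%N ->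
     \sum_(s in X | (#|s| == #|t|.+1) && (t \subset s)) m s = m t).

Definition link_weight m (t : {set V}) : {set V} -> R := fun s => m (t :|: s).

End Weights.

Section Cochains.
Variables (R : realType) (V : finType).
Implicit Types (X : {set {set V}}) (m : {set V} -> R) (p : nat).

Definition tuple_fun p := {ffun p.-tuple V -> R^o}.

Definition off_simplices X p (phi : tuple_fun p) : tuple_fun p :=
  [ffun t => if ordered_simplex X t then 0 else phi t].

Definition antisym_defect p (g : 'S_p) (phi : tuple_fun p) : tuple_fun p :=
  [ffun t => phi (permute g t) - (-1) ^+ odd_perm g * phi t].

Fact off_simplices_linear X p : linear (@off_simplices X p).
Proof.
move=> a u v; apply/ffunP=> t; rewrite !ffunE.
by case: ifP => // _; rewrite scaler0 addr0.
Qed.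
HB.instance Definition _ X p := GRing.isLinear.Build R (tuple_fun p)
  (tuple_fun p) _ (@off_simplices X p) (@off_simplices_linear X p).

Fact antisym_defect_linear p (g : 'S_p) : linear (antisym_defect g).
Proof.
move=> a u v; apply/ffunP=> t; rewrite !ffunE mulrDr scalerBr opprD addrACA.
by congr (_ + (_ - _)); rewrite /GRing.scale /= mulrCA.
Qed.
HB.instance Definition _ p (g : 'S_p) := GRing.isLinear.Build R (tuple_fun p)
  (tuple_fun p) _ (antisym_defect g) (antisym_defect_linear g).

(* C^(p-1)(X, R): antisymmetric functions on ordered simplices with p vertices,
   extended by 0 to the other p-tuples (see cochainP). *)
Definition cochain X p : {vspace tuple_fun p} :=
  (lker (linfun (@off_simplices X p)) :&:
   \bigcap_(g : 'S_p) lker (linfun (antisym_defect g)))%VS.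

Lemma cochainP X p (phi : tuple_fun p) :
  reflect ((forall t, ~~ ordered_simplex X t -> phi t = 0) /\
           (forall (g : 'S_p) t, phi (permute g t) = (-1) ^+ odd_perm g * phi t))
          (phi \in cochain X p).
Proof.
rewrite memv_cap memv_ker lfunE /=.
apply: (iffP andP) => [[/eqP off /subv_bigcapP anti]|[off anti]]; split.
- by move=> t nXt; move/ffunP/(_ t): off; rewrite !ffunE (negbTE nXt).
- move=> g t; have := anti g isT; rewrite -memvE memv_ker lfunE /=.
  by move=> /eqP/ffunP/(_ t); rewrite !ffunE => /eqP; rewrite subr_eq0 => /eqP.
- by apply/eqP/ffunP=> t; rewrite !ffunE; case: ifPn => // /off.
- apply/subv_bigcapP=> g _; rewrite -memvE memv_ker lfunE /=.
  by apply/eqP/ffunP=> t; rewrite !ffunE anti subrr.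
Qed.

Definition C X p := subvs_of (cochain X p).

Definition inner X m p (phi psi : C X p) : R :=
  \sum_(t : p.-tuple V | ordered_simplex X t)
    m (supp t) / (p`!)%:R * (vsval phi t * vsval psi t).

Definition diff_fun X p (phi : tuple_fun p) : tuple_fun p.+1 :=
  [ffun t => if ordered_simplex X t
             then \sum_(i < p.+1) (-1) ^+ i * phi (face i t) else 0].

Lemma diff_fun_cochain X p (phi : tuple_fun p) :
  phi \in cochain X p -> diff_fun X phi \in cochain X p.+1.
Proof.
move=> /cochainP[_ anti]; apply/cochainP; split=> [t /negbTE nXt|g t].
  by rewrite ffunE nXt.
rewrite !ffunE ordered_simplex_permute; case: ifP; rewrite ?mulr0 // => _.
rewrite mulr_sumr [RHS](reindex_inj (@perm_inj _ g)); apply: eq_bigr => i _.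
have [h [gE ->]] := face_permute V g i.
rewrite anti !mulrA; congr (_ * _).
rewrite -(signr_odd _ i) -(signr_odd _ (g i)) -!signr_addb gE; congr ((-1) ^+ _).
by case: (odd i); case: (odd (g i)); case: (odd_perm h).
Qed.

(* d_(p-1); vsproj acts here as the inclusion into C X p.+1, see diffE. *)
Definition diff X p : 'Hom(C X p, C X p.+1) :=
  linfun (fun phi : C X p => vsproj (cochain X p.+1) (diff_fun X (vsval phi))).

Fact diff_linear X p :
  linear (fun phi : C X p => vsproj (cochain X p.+1) (diff_fun X (vsval phi))).
Proof.
move=> a u v; rewrite -linearP; congr (vsproj _ _); apply/ffunP=> t.
rewrite !ffunE; case: ifP; rewrite ?scaler0 ?addr0 // => _.
rewrite scaler_sumr -big_split; apply: eq_bigr => i _ /=.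
by rewrite !ffunE mulrDr /GRing.scale /= mulrCA.
Qed.

Lemma diffE X p (phi : C X p) : vsval (diff X p phi) = diff_fun X (vsval phi).
Proof.
pose H := GRing.isLinear.Build _ _ _ _ _ (@diff_linear X p).
pose L : {linear C X p -> C X p.+1} := HB.pack (fun phi : C X p =>
  vsproj (cochain X p.+1) (diff_fun X (vsval phi))) H.
have -> : diff X p phi = L phi by rewrite -(lfunE L).
by rewrite /= vsprojK // diff_fun_cochain // subvsP.
Qed.

End Cochains.

Section Adjoint.
Variables (R : realType) (U W : vectType R).
Variables (dotU : U -> U -> R) (dotW : W -> W -> R).

Definition is_adjoint (f : 'Hom(U, W)) (g : 'Hom(W, U)) : Prop :=
  forall u w, dotW (f u) w = dotU u (g w).

(* The zero map if f has no adjoint; see adjointP for existence. *)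
Definition adjoint (f : 'Hom(U, W)) : 'Hom(W, U) :=
  xget 0 [set g | is_adjoint f g]%classic.

Hypothesis dotUl : forall v, linear (fun u => dotU u v : R^o).
Hypothesis dotUr : forall u, linear (dotU u : U -> R^o).
Hypothesis dotWl : forall v, linear (fun u => dotW u v : R^o).
Hypothesis dotWr : forall u, linear (dotW u : W -> R^o).
Hypothesis dotU0 : forall u, dotU u u = 0 -> u = 0.

Lemma adjoint_unique f g1 g2 : is_adjoint f g1 -> is_adjoint f g2 -> g1 = g2.
Proof.
move=> a1 a2; apply/lfunP=> w; apply/eqP; rewrite -subr_eq0; apply/eqP/dotU0.
rewrite -scaleN1r addrC; have := dotUr (-1 *: g2 w + g1 w) (-1) (g2 w) (g1 w).
by move=> ->; rewrite -a1 -a2 scaleN1r addNr.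
Qed.

Lemma adjointP f : is_adjoint f (adjoint f).
Proof.
suff [g gP] : exists g, is_adjoint f g by exact: (xgetI _ gP).
have lfE (A B : vectType R) (h : A -> B) : linear h -> linfun h =1 h.
  move=> hl; pose H := GRing.isLinear.Build _ _ _ _ h hl.
  by pose L : {linear A -> B} := HB.pack h H; apply: (lfunE L).
pose Phi (v : U) : 'Hom(U, R^o) := linfun (fun u => dotU u v : R^o).
pose Psi (w : W) : 'Hom(U, R^o) := linfun (fun u => dotW (f u) w : R^o).
have PhiE v u : Phi v u = dotU u v by apply: lfE.
have PsiE w u : Psi w u = dotW (f u) w.
  by apply: lfE => a x y; rewrite linearP; apply: dotWl.
have PhiL : linear Phi.
  move=> a x y; apply/lfunP=> u; rewrite add_lfunE scale_lfunE !PhiE.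
  exact: dotUr.
have PsiL : linear Psi.
  move=> a x y; apply/lfunP=> u; rewrite add_lfunE scale_lfunE !PsiE.
  exact: dotWr.
have ker0 : lker (linfun Phi) == 0%VS.
  apply/lker0P=> x y; rewrite !lfE // => e; apply/eqP; rewrite -subr_eq0.
  apply/eqP/dotU0; rewrite -scaleN1r addrC dotUr -!PhiE e.
  by rewrite !scaleN1r addNr.
have full : limg (linfun Phi) = fullv.
  apply/eqP; rewrite eqEdim subvf limg_dim_eq ?(eqP ker0) ?capv0 //.
  by rewrite !dimvf /vector.dim /= ?muln1.
exists (((linfun Phi)^-1 \o linfun Psi)%VF) => u w.
have wP : linfun Psi w \in limg (linfun Phi) by rewrite full memvf.
by rewrite comp_lfunE -PhiE -[Phi _](lfE _ _ _ PhiL) limg_lfunVK // lfE // PsiE.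
Qed.

End Adjoint.

Section Laplacians.
Variables (R : realType) (V : finType).
Implicit Types (X : {set {set V}}) (m : {set V} -> R) (p k : nat).

(* delta_(p-1) *)
Definition codiff X m p : 'Hom(C R X p.+1, C R X p) :=
  adjoint (@inner R V X m p) (@inner R V X m p.+1) (diff R X p).

Lemma codiffP X m p : (forall s, s \in X -> 0 < m s) ->
  is_adjoint (@inner R V X m p) (@inner R V X m p.+1) (diff R X p)
    (codiff X m p).
Proof.
move=> m_gt0.
have ir q (u : C R X q) : linear (inner m u : C R X q -> R^o).
  move=> a x y; rewrite /inner scaler_sumr -big_split; apply: eq_bigr => t _ /=.
  rewrite !ffunE !mulrDr /GRing.scale /=; congr (_ + _).
  exact: (etrans (congr1 _ (mulrCA _ _ _)) (mulrCA _ _ _)).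
have ic q (u v : C R X q) : inner m u v = inner m v u.
  by apply: eq_bigr => t _; rewrite [X in _ * X]mulrC.
have il q (v : C R X q) : linear (fun u => inner m u v : R^o).
  by move=> a x y; rewrite ic ir -!(ic _ v).
apply: adjointP; [exact: il|exact: ir|exact: il|exact: ir|move=> u u0].
apply: subvs_inj; apply/ffunP=> t /=; rewrite [RHS]ffunE.
have /cochainP[off _] := subvsP u.
have [Xt|/off //] := boolP (ordered_simplex X t).
have c_gt0 (s : p.-tuple V) : ordered_simplex X s -> 0 < m (supp s) / p`!%:R.
  by move=> /andP[_ Xs]; rewrite divr_gt0 ?m_gt0 // ltr0n fact_gt0.
move: u0 => /eqP; rewrite psumr_eq0 => [/allP/(_ t)|s /c_gt0/ltW c_ge0].
  rewrite mem_index_enum Xt /= => /(_ isT).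
  by rewrite mulf_eq0 gt_eqF ?c_gt0 //= -expr2 sqrf_eq0 => /eqP.
by rewrite mulr_ge0 // -expr2 sqr_ge0.
Qed.

(* Delta_k^+ and Delta_k^-, for k >= 0 *)
Definition laplacian_up X m k : 'End(C R X k.+1) :=
  (codiff X m k.+1 \o diff R X k.+1)%VF.

Definition laplacian_down X m k : 'End(C R X k.+1) :=
  (diff R X k \o codiff X m k)%VF.

Definition spec (U : vectType R) (T : 'End(U)) : set R :=
  [set a | passmx.leigenvalue T a]%classic.

Lemma specP (U : vectType R) (T : 'End(U)) a :
  spec T a <-> exists2 u : U, u != 0 & T u = a *: u.
Proof.
rewrite /spec /= /passmx.leigenvalue /passmx.leigenspace; split.
  rewrite -vpick0 => u_neq0; exists (vpick (lker (T - a *: \1%VF))) => //.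
  apply/eqP; rewrite -subr_eq0; have := memv_pick (lker (T - a *: \1%VF)).
  by rewrite memv_ker add_lfunE opp_lfunE scale_lfunE id_lfunE.
move=> [u u_neq0 Tu]; apply: contraNneq u_neq0 => k0; rewrite -memv0 -k0.
by rewrite memv_ker add_lfunE opp_lfunE scale_lfunE id_lfunE Tu subrr.
Qed.

Definition f (x : R) : R := 2 - 1 / x.

End Laplacians.

(* Main.v *)
Require Import Defs.
From HB Require Import structures.
From mathcomp Require Import all_boot all_order all_fingroup all_algebra.
From mathcomp Require Import boolp classical_sets set_interval reals.
From mathcomp Require Import complex ring lra zify.

Set Implicit Arguments.
Unset Strict Implicit.
Unset Printing Implicit Defensive.

Import Order.TTheory GRing.Theory Num.Theory.
Local Open Scope ring_scope.

(** The theorem is a local-to-global principle: the Laplacian spectra of a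
  weighted complex are controlled by the weighted graphs that its links have as
  1-skeletons.  For an ordered simplex [l], such a graph gives the vertex [u]
  the weight [m(ul)] and the edge [uv] the weight [m(uvl)]; balancedness says
  that a vertex weighs as much as the edges through it.  [spectral_gap] states
  that on functions of mean zero the Dirichlet energy of a graph lies between
  [lam] and [kap] times the squared norm.

  Spectrum and gap.  If the graph is connected, then a gap follows from the
  same bounds on the nonzero eigenvalues ([spectral_gap_of_eigen]): a function
  is a sum of pairwise orthogonal eigenfunctions, and the one of eigenvalue 0,
  being constant, is orthogonal to functions of mean zero.

  Descent.  Let [g] be an eigenfunction, of eigenvalue [r], of the graph of
  [l].  The graphs of the simplices [vl], over all vertices [v], have energies
  of [g] adding up to the energy of [g], and squared norms adding up to its
  squared norm, while the mean of [g] over the neighbours of [v] is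
  [(1 - r) * g v].  Gaps [lam] and [kap] in all these graphs thus give
    [lam * (1 - (1 - r)^2) <= r <= kap * (1 - (1 - r)^2)],
  which for [r] nonzero is [f lam <= r <= f kap] ([spectral_gap_descent]).
  The bound on [lambda] keeps the iterates positive, as the argument requires:
  [f] maps [d / (d + 1)] to [(d - 1) / d].

  Garland's method.  A cochain [phi] on the ordered simplices with [k + 1]
  vertices localizes to the functions [u |-> phi(us)] on the graphs of the
  ordered simplices [s] with [k] vertices.  Up to factorials, their squared
  norms add up to [(k + 1) |phi|^2] and their energies to
  [|d phi|^2 + k |phi|^2]; if [phi] is an eigenvector of nonzero eigenvalue
  [r] of the upper Laplacian then it lies in the image of the codifferential,
  so it is coclosed, that is, all its localizations have mean zero.  The gaps
  then enclose [r + k] between [(k + 1) lam] and [(k + 1) kap]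
  ([garland_bounds]).

  Finally the codifferential maps eigenvectors of the lower Laplacian with a
  nonzero eigenvalue to eigenvectors of the upper one with the same
  eigenvalue. *)

(** * Eigenvector decomposition for self-adjoint matrices *)

Section SelfAdjoint.
Variables (R : rcfType) (n : nat) (A : 'M[R]_n.+1).
Implicit Types (x y z : 'rV[R]_n.+1) (p q : {poly R}).

(** Row vectors as a module over polynomials, ['X] acting by [A]. *)
Definition polyact x p := x *m horner_mx A p.

Lemma polyactM x p q : polyact x (p * q) = polyact (polyact x p) q.
Proof. by rewrite /polyact -mulmxA -[_ *m horner_mx A q]rmorphM. Qed.

Lemma polyact_XsubC x (a : R) : polyact x ('X - a%:P) = x *m A - a *: x.
Proof.
by rewrite /polyact rmorphB /= horner_mx_X horner_mx_C mulmxBr mul_mx_scalar.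
Qed.

Variable dot : 'rV[R]_n.+1 -> 'rV[R]_n.+1 -> R.
Hypothesis dot_linearl : forall z, scalar (dot^~ z).
Hypothesis dotC : forall x y, dot x y = dot y x.
Hypothesis dot_gt0 : forall x, x != 0 -> 0 < dot x x.
Hypothesis A_adj : forall x y, dot (x *m A) y = dot x (y *m A).

Let dotDl x y z : dot (x + y) z = dot x z + dot y z.
Proof. by rewrite -[x]scale1r dot_linearl mul1r scale1r. Qed.

Let dot0l z : dot 0 z = 0.
Proof. by apply/(addrI (dot 0 z)); rewrite -dotDl !addr0. Qed.

Let dotZl a x z : dot (a *: x) z = a * dot x z.
Proof. by rewrite -[a *: x]addr0 dot_linearl dot0l addr0. Qed.

Let dot_eq0 x : dot x x <= 0 -> x = 0.
Proof.
by move=> x_le0; apply/eqP; apply: contraLR x_le0 => /dot_gt0; rewrite -ltNge.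
Qed.

Let shift_adj (a : R) x y : dot (x *m A - a *: x) y = dot x (y *m A - a *: y).
Proof.
rewrite -!scaleNr dotDl dotZl A_adj.
by rewrite [RHS]dotC dotDl dotZl [dot _ x]dotC [dot y x]dotC.
Qed.

(** The form of [(A - a)^2 + b^2] at [x] is [|x(A - a)|^2 + b^2 |x|^2]: a
  self-adjoint matrix has no non-real eigenvalue. *)
Lemma quadratic_polyact_inj (a b : R) (x : 'rV[R]_n.+1) :
  b != 0 -> polyact x (('X - a%:P) ^+ 2 + (b ^+ 2)%:P) = 0 -> x = 0.
Proof.
move=> b_neq0.
rewrite /polyact rmorphD rmorphXn rmorphB /= horner_mx_X !horner_mx_C.
set B := A - _; have B_adj u v : dot (u *m B) v = dot u (v *m B).
  by rewrite !mulmxBr !mul_mx_scalar shift_adj.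
rewrite mulmxDr expr2 mul_mx_scalar mulmxA => e.
have : dot (x *m B *m B + b ^+ 2 *: x) x = 0 by rewrite e dot0l.
rewrite dotDl dotZl B_adj => e0.
apply: dot_eq0; rewrite leNgt; apply/negP=> x_gt0.
have : 0 < b ^+ 2 * dot x x by rewrite mulr_gt0 // exprn_even_gt0.
have : 0 <= dot (x *m B) (x *m B).
  by have [->|/dot_gt0/ltW //] := eqVneq (x *m B) 0; rewrite dot0l.
lra.
Qed.

(** Since [|x(A - a)|^2] is the product of [x(A - a)^2] and [x]. *)
Lemma double_root_simple (a : R) (x : 'rV[R]_n.+1) :
  polyact x (('X - a%:P) ^+ 2) = 0 -> polyact x ('X - a%:P) = 0.
Proof.
rewrite expr2 polyactM; set y := polyact x _.
rewrite polyact_XsubC => yA; apply: dot_eq0.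
by rewrite {1}/y polyact_XsubC shift_adj yA dotC dot0l.
Qed.

Lemma size_quadratic (a b : R) :
  size (('X - a%:P) ^+ 2 + (b ^+ 2)%:P) = 3%N.
Proof. by rewrite size_polyDl size_exp_XsubC // size_polyC; case: (_ != 0). Qed.

(** Take a complex root [a + ib].  If [b] is nonzero, the remainder of [p] by
  the quadratic has degree at most 1 and a non-real root, so it vanishes. *)
Lemma real_or_quadratic_factor (p : {poly R}) : (1 < size p)%N ->
  (exists a, root p a) \/
  exists a b, b != 0 /\ ('X - a%:P) ^+ 2 + (b ^+ 2)%:P %| p.
Proof.
move=> p_gt1; pose C := complex R.
have /closed_rootP[[a b] /=] : size (map_poly (real_complex R) p) != 1%N.
  by rewrite size_map_poly gtn_eqF.
set z : C := (a +i* b)%C => pz0.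
have [b0|b_neq0] := eqVneq b 0.
  left; exists a; move: pz0; rewrite /z b0.
  by rewrite -[(a +i* 0)%C]/(real_complex R a) fmorph_root.
right; exists a, b; split=> //; set q := _ + _.
have size_q : size q = 3%N := size_quadratic a b.
have q_neq0 : q != 0 by rewrite -size_poly_gt0 size_q.
have qz0 : (map_poly (real_complex R) q).[z] = 0.
  rewrite !rmorphD rmorphXn rmorphB /= map_polyX !map_polyC /= !hornerE.
  by apply/eqP; rewrite eq_complex /=; apply/andP; split; apply/eqP; ring.
have rz0 : (map_poly (real_complex R) (p %% q)).[z] = 0.
  move/rootP: pz0; rewrite {1}(divp_eq p q) rmorphD rmorphM /=.
  by rewrite hornerD hornerM qz0 mulr0 add0r.
have : (size (p %% q)%R <= 2)%N by rewrite -ltnS -size_q ltn_modp.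
rewrite /dvdp => size_r; move: rz0 size_r; set r := p %% q => rz0 size_r.
have rE : r = (r`_0)%:P + (r`_1)%:P * 'X.
  apply/polyP=> -[|[|i]]; rewrite coefD coefC coefMX coefC /= ?addr0 ?add0r //.
  by rewrite nth_default // (leq_trans size_r).
move: rz0; rewrite rE rmorphD rmorphM /= map_polyX !map_polyC /= !hornerE.
move=> /eqP; rewrite eq_complex /= => /andP[/eqP e1 /eqP e2].
(* Real and imaginary parts of [r`_0 + r`_1 (a + ib) = 0]. *)
have r1 : r`_1 = 0.
  by apply/eqP; move/eqP: e2; rewrite mul0r addr0 add0r mulf_eq0 (negPf b_neq0) orbF.
move: e1; rewrite r1 !mul0r subr0 addr0 => r0.
by rewrite r0 polyC0 addr0.
Qed.

(** Quadratic factors can be cancelled because they act injectively, and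
  repeated roots because [(A - a)^2] and [A - a] have the same kernel. *)
Lemma annihilated_by_simple_roots (p : {poly R}) (x : 'rV[R]_n.+1) :
  p != 0 -> polyact x p = 0 ->
  exists2 rs : seq R, uniq rs &
    polyact x (\prod_(r <- rs) ('X - r%:P)) = 0.
Proof.
have [k] := ubnP (size p); elim: k p x => // k IHk p x; rewrite ltnS => size_p.
move=> p_neq0 xp0; have [p_le1|p_gt1] := leqP (size p) 1.
  exists [::] => //; rewrite /polyact big_nil rmorph1 mulmx1.
  move: xp0 p_neq0; rewrite /polyact (size1_polyC p_le1) horner_mx_C mul_mx_scalar.
  by rewrite polyC_eq0 => /eqP; rewrite scaler_eq0 => /orP[->|/eqP].
have [[a]|[a [b [b_neq0]]]] := real_or_quadratic_factor p_gt1.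
  rewrite -dvdp_XsubCl => /dvdpP[q pE].
  have q_neq0 : q != 0 by apply: contraNneq p_neq0; rewrite pE => ->; rewrite mul0r.
  have size_q : (size q < k)%N.
    move: size_p; rewrite pE size_mul ?polyXsubC_eq0 // size_XsubC.
    by rewrite addn2.
  have x'q0 : polyact (polyact x ('X - a%:P)) q = 0.
    by rewrite -polyactM mulrC -pE.
  have [rs urs x'rs] := IHk _ _ size_q q_neq0 x'q0.
  have [a_rs|a_rs] := boolP (a \in rs); last first.
    by exists (a :: rs); rewrite /= ?a_rs // big_cons polyactM.
  exists rs => //; move: x'rs; rewrite (big_rem a) //=.
  rewrite -polyactM mulrA -expr2 mulrC polyactM.
  by move=> /double_root_simple; rewrite -polyactM mulrC.
move=> /dvdpP[q pE].
have q_neq0 : q != 0 by apply: contraNneq p_neq0; rewrite pE => ->; rewrite mul0r.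
apply: (IHk q x _ q_neq0).
  move: size_p; rewrite pE size_mul // -?size_poly_gt0 size_quadratic //.
  by rewrite addn3; apply: ltn_trans.
by apply: (@quadratic_polyact_inj a b) => //; rewrite -polyactM -pE.
Qed.

(** Induction on the roots.  If [x(A - a)] is the sum of the eigenvectors
  [y r], then [x] minus the sum of the [y r / (r - a)] is annihilated by
  [A - a]. *)
Lemma simple_roots_eigen_sum (rs : seq R) (x : 'rV[R]_n.+1) :
  uniq rs -> polyact x (\prod_(r <- rs) ('X - r%:P)) = 0 ->
  exists2 y : R -> 'rV[R]_n.+1,
    forall r, y r *m A = r *: y r & x = \sum_(r <- rs) y r.
Proof.
elim: rs x => [|a rs IHrs] x /=.
  rewrite /polyact big_nil rmorph1 mulmx1 => _ ->.
  exists (fun=> 0); last by rewrite big_nil.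
  by move=> r; rewrite mul0mx scaler0.
move=> /andP[a_rs urs]; rewrite big_cons polyactM.
case/(IHrs _ urs) => y yA x'E.
pose z := x - \sum_(r <- rs) (r - a)^-1 *: y r.
exists (fun r => if r == a then z else (r - a)^-1 *: y r); last first.
  rewrite big_cons eqxx [X in _ + X](_ : _ = \sum_(r <- rs) (r - a)^-1 *: y r).
    by rewrite subrK.
  by apply: eq_big_seq => b b_rs; case: eqP b_rs a_rs => // -> ->.
move=> r; case: eqP => [->|_]; last by rewrite -scalemxAl yA !scalerA mulrC.
apply/eqP; rewrite -subr_eq0; apply/eqP.
rewrite -polyact_XsubC /polyact mulmxBl -/(polyact x _) x'E mulmx_suml -sumrB.
rewrite big_seq big1 // => b b_rs; rewrite -scalemxAl -/(polyact _ _).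
rewrite polyact_XsubC yA -scalerBl scalerA mulVf ?scale1r ?subrr // subr_eq0.
by apply: contraNneq a_rs => <-.
Qed.
End SelfAdjoint.

(** By Cayley-Hamilton, some nonzero polynomial annihilates every vector.  The
  eigenvectors are indexed by distinct eigenvalues, so that self-adjointness
  makes them pairwise orthogonal. *)
Lemma spectral_decomposition (R : rcfType) (n : nat) (A : 'M[R]_n)
    (dot : 'rV[R]_n -> 'rV[R]_n -> R) :
  (forall z, scalar (dot^~ z)) -> (forall x y, dot x y = dot y x) ->
  (forall x, x != 0 -> 0 < dot x x) ->
  (forall x y, dot (x *m A) y = dot x (y *m A)) ->
  forall x, exists2 rs : seq R, uniq rs & exists2 y : R -> 'rV[R]_n,
    forall r, y r *m A = r *: y r & x = \sum_(r <- rs) y r.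
Proof.
case: n A dot => [|n] A dot dotl dotC dot_gt0 A_adj x.
  exists [::] => //; exists (fun=> 0) => [r|]; last by rewrite big_nil [x]thinmx0.
  by rewrite mul0mx scaler0.
have [||rs urs xrs] := @annihilated_by_simple_roots _ _ A _ dotl dotC dot_gt0 A_adj
  (char_poly A) x.
- exact/monic_neq0/char_poly_monic.
- by rewrite /polyact Cayley_Hamilton mulmx0.
by exists rs => //; apply: simple_roots_eigen_sum.
Qed.


(** The matrix with entries [L u v / a v] acting on rows is self-adjoint for the
  scalar product of weight [a]. *)
Lemma symmetric_kernel_eigen_sum (R : rcfType) (V : finType) (a : V -> R)
    (L : V -> V -> R) : (forall u, 0 < a u) -> (forall u v, L u v = L v u) ->
  forall g : V -> R, exists2 rs : seq R, uniq rs & exists2 h : R -> V -> R,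
    forall r u, \sum_v L u v * h r v = r * (a u * h r u)
    & forall u, g u = \sum_(r <- rs) h r u.
Proof.
move=> a_gt0 L_sym g; pose e (i : 'I_#|V|) : V := enum_val i.
have sumE (F : V -> R) : \sum_v F v = \sum_i F (e i) by rewrite -big_enum_val.
pose A : 'M[R]_#|V| := \matrix_(i, j) (L (e i) (e j) / a (e j)).
pose dot (x y : 'rV[R]_#|V|) := \sum_i a (e i) * x 0 i * y 0 i.
have mulA (x : 'rV_#|V|) j : a (e j) * (x *m A) 0 j = \sum_i L (e i) (e j) * x 0 i.
  rewrite mxE mulr_sumr; apply: eq_bigr => i _; rewrite mxE.
  by rewrite mulrC mulrA mulfVK ?lt0r_neq0 // mulrC.
have dotl z : scalar (dot^~ z).
  move=> c x y; rewrite /dot mulr_sumr -big_split; apply: eq_bigr => i _ /=.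
  by rewrite !mxE; ring.
have dotC x y : dot x y = dot y x by apply: eq_bigr => i _; rewrite mulrAC.
have term_ge0 (x : 'rV_#|V|) i : 0 <= a (e i) * x 0 i * x 0 i.
  by rewrite -mulrA mulr_ge0 ?(ltW (a_gt0 _)) // -expr2 sqr_ge0.
have dot_gt0 x : x != 0 -> 0 < dot x x.
  move=> x_neq0; rewrite lt0r sumr_ge0 ?andbT //; apply: contraNneq x_neq0 => /eqP.
  rewrite psumr_eq0 // => /allP x0; apply/eqP/rowP=> i; rewrite mxE.
  have := x0 i; rewrite mem_index_enum => /(_ isT).
  by rewrite -mulrA mulf_eq0 gt_eqF //= -expr2 sqrf_eq0 => /eqP.
have A_adj x y : dot (x *m A) y = dot x (y *m A).
  have dotA z t : dot (z *m A) t = \sum_j \sum_i L (e i) (e j) * z 0 i * t 0 j.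
    by apply: eq_bigr => j _; rewrite mulA mulr_suml.
  rewrite [RHS]dotC !dotA [RHS]exchange_big; apply: eq_bigr => j _ /=.
  by apply: eq_bigr => i _; rewrite L_sym mulrAC.
have [rs urs [y yA gE]] :=
  spectral_decomposition dotl dotC dot_gt0 A_adj (\row_i g (e i)).
exists rs => //; exists (fun r u => y r 0 (enum_rank u)) => [r u|u].
  rewrite sumE -[u in LHS]enum_rankK -/(e _); set j := enum_rank u.
  have := mulA (y r) j; rewrite yA mxE mulrCA {1}/e enum_rankK => ->.
  by apply: eq_bigr => i _; rewrite L_sym /e enum_valK.
by rewrite -summxE -gE mxE /e enum_rankK.
Qed.

(** * Weighted graphs: eigenfunctions and spectral gaps *)

Section WeightedGraph.
Variables (R : realType) (V : finType).
Implicit Types (a g h : V -> R) (w : V -> V -> R) (lam kap r : R).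

Definition dotw a g h := \sum_u a u * g u * h u.
Definition energy w g h := 2^-1 * \sum_u \sum_v w u v * ((g u - g v) * (h u - h v)).
(** Weak form of the eigenvalue equation of the normalized Laplacian: no
  division by the weight of [u], which may vanish. *)
Definition eigenfun a w r g :=
  forall u, \sum_v w u v * (g u - g v) = r * (a u * g u).

Definition spectral_gap a w lam kap := forall g, \sum_u a u * g u = 0 ->
  lam * dotw a g g <= energy w g g <= kap * dotw a g g.

Definition symmetric_weights w := forall u v, w u v = w v u.

(** Green's formula. *)
Lemma energyE w g h : symmetric_weights w ->
  energy w g h = \sum_u h u * \sum_v w u v * (g u - g v).
Proof.
move=> w_sym; rewrite /energy.
pose F u v := h u * (w u v * (g u - g v)).
have -> : \sum_u \sum_v w u v * ((g u - g v) * (h u - h v)) =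
    \sum_u \sum_v F u v + \sum_u \sum_v F u v.
  rewrite [X in _ + X]exchange_big -big_split; apply: eq_bigr => u _ /=.
  rewrite -big_split; apply: eq_bigr => v _; rewrite /F /= [w v u]w_sym; ring.
have -> x : 2^-1 * (x + x) = x :> R by field.
by apply: eq_bigr => u _; rewrite mulr_sumr.
Qed.

Lemma energyC w g h : energy w g h = energy w h g.
Proof.
rewrite /energy; congr (_ * _); apply: eq_bigr => u _; apply: eq_bigr => v _.
by rewrite [X in _ * X]mulrC.
Qed.

Lemma energy_ge0 w g : (forall u v, 0 <= w u v) -> 0 <= energy w g g.
Proof.
move=> w_ge0; rewrite mulr_ge0 ?invr_ge0 ?ler0n //.
by do 2!apply: sumr_ge0 => ? _; rewrite mulr_ge0 // -expr2 sqr_ge0.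
Qed.

Lemma energy_eigenfun a w r g h : symmetric_weights w -> eigenfun a w r g ->
  energy w g h = r * dotw a g h.
Proof.
move=> w_sym gr; rewrite energyE // mulr_sumr; apply: eq_bigr => u _.
by rewrite gr; ring.
Qed.

Lemma dotwC a g h : dotw a g h = dotw a h g.
Proof. by apply: eq_bigr => u _; rewrite mulrAC. Qed.

Lemma dotw_ge0 a g : (forall u, 0 <= a u) -> 0 <= dotw a g g.
Proof.
by move=> a0; apply: sumr_ge0 => u _; rewrite -mulrA mulr_ge0 // -expr2 sqr_ge0.
Qed.

Lemma eigenfun_orthogonal a w r s g h : symmetric_weights w ->
  eigenfun a w r g -> eigenfun a w s h -> r != s -> dotw a g h = 0.
Proof.
move=> w_sym gr hs rs; apply/eqP; have := energy_eigenfun h w_sym gr.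
rewrite energyC (energy_eigenfun g w_sym hs) dotwC => /eqP.
by rewrite -subr_eq0 -mulrBl mulf_eq0 subr_eq0 eq_sym (negPf rs).
Qed.

(** Connectedness of the graph of edges of positive weight between the vertices
  of positive weight, in the form in which it is used: locally constant
  functions are constant. *)
Definition connected_weights a w := forall h,
  (forall u v, 0 < w u v -> h u = h v) ->
  forall u v, 0 < a u -> 0 < a v -> h u = h v.

Section Gap.
Variables (a : V -> R) (w : V -> V -> R).
Hypothesis w_sym : symmetric_weights w.
Hypothesis w_ge0 : forall u v, 0 <= w u v.
Hypothesis degE : forall u, \sum_v w u v = a u.

Let a_ge0 u : 0 <= a u.
Proof. by rewrite -degE sumr_ge0. Qed.

Let w_eq0 u v : a u = 0 -> w u v = 0.
Proof.
move=> /eqP; rewrite -degE psumr_eq0 // => /allP/(_ v).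
by rewrite mem_index_enum => /(_ isT)/eqP.
Qed.

(** Vertices of weight 0 would make the scalar product degenerate, so they are
  given the weight 1.  This creates no spurious eigenfunction: such vertices
  have no edge, so they only contribute to the eigenvalue 0. *)
Lemma eigenfun_sum g : exists2 rs : seq R, uniq rs & exists2 h : R -> V -> R,
  forall r, eigenfun a w r (h r) & forall u, g u = \sum_(r <- rs) h r u.
Proof.
pose a' u := if a u == 0 then 1 else a u.
have a'_gt0 u : 0 < a' u.
  by rewrite /a'; case: eqP => // /eqP; rewrite lt0r a_ge0 => ->.
pose L u v := (u == v)%:R * a u - w u v.
have L_sym u v : L u v = L v u.
  by rewrite /L w_sym eq_sym; have [->//|_] := eqVneq v u; rewrite !mul0r.
have [rs urs [h hL gE]] := symmetric_kernel_eigen_sum a'_gt0 L_sym g.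
exists rs => //; exists h => // r u.
have -> : \sum_v w u v * (h r u - h r v) = \sum_v L u v * h r v.
  rewrite [LHS](eq_bigr (fun v => w u v * h r u - w u v * h r v)); last first.
    by move=> v _; rewrite mulrBr.
  rewrite [RHS](eq_bigr (fun v => (u == v)%:R * a u * h r v - w u v * h r v)).
    rewrite !sumrB -mulr_suml degE [X in _ = X - _](bigD1 u) //= eqxx mul1r.
    rewrite [X in _ + X - _]big1 ?addr0 // => v.
    by rewrite eq_sym => /negPf->; rewrite !mul0r.
  by move=> v _; rewrite mulrBl.
rewrite hL /a'; case: eqP => // au0.
have := hL r u; rewrite /a' au0 eqxx !mul1r big1 => [<-|v _].
  by rewrite mul0r mulr0.
by rewrite /L au0 mulr0 w_eq0 // subrr mul0r.
Qed.

(** On mean-zero [g], norm and energy split along the eigenfunctions [h r] of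
  which [g] is the sum.  The component [h 0] has zero energy, hence is constant
  by connectedness, hence orthogonal to [g], hence of norm 0. *)
Lemma spectral_gap_of_eigen lam kap : connected_weights a w ->
  (forall r g, eigenfun a w r g -> 0 < dotw a g g -> r != 0 -> lam <= r <= kap) ->
  spectral_gap a w lam kap.
Proof.
move=> conn bounds g g_mean0; have [rs urs [h hr gE]] := eigenfun_sum g.
have dot_hg r : r \in rs -> dotw a (h r) g = dotw a (h r) (h r).
  move=> r_rs; have -> : dotw a (h r) g = \sum_(s <- rs) dotw a (h r) (h s).
    by rewrite exchange_big; apply: eq_bigr => u _ /=; rewrite gE mulr_sumr.
  rewrite (bigD1_seq r) //= big1 ?addr0 // => s sr.
  by apply: eigenfun_orthogonal (hr r) (hr s) _; rewrite 1?eq_sym.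
have dot_g : dotw a g g = \sum_(r <- rs) dotw a (h r) (h r).
  rewrite -(eq_big_seq _ dot_hg) exchange_big; apply: eq_bigr => u _ /=.
  by rewrite -mulr_suml -mulr_sumr -gE.
have energy_g : energy w g g = \sum_(r <- rs) r * dotw a (h r) (h r).
  rewrite energyE // (eq_bigr (fun u => \sum_(r <- rs) r * (a u * h r u * g u))).
    rewrite exchange_big; apply: eq_big_seq => r r_rs /=.
    by rewrite -mulr_sumr -dot_hg.
  move=> u _.
  have -> : \sum_v w u v * (g u - g v) =
      \sum_v \sum_(r <- rs) w u v * (h r u - h r v).
    by apply: eq_bigr => v _; rewrite !gE -sumrB mulr_sumr.
  rewrite exchange_big mulr_sumr; apply: eq_bigr => r _.
  by rewrite hr; ring.
have h0 : 0 \in rs -> dotw a (h 0) (h 0) = 0.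
  move=> rs0; rewrite -dot_hg //.
  have h0_edge u v : 0 < w u v -> h 0 u = h 0 v.
    move=> wuv; apply/eqP; rewrite -subr_eq0 -sqrf_eq0.
    have := energy_eigenfun (h 0) w_sym (hr 0); rewrite mul0r => /eqP.
    rewrite mulf_eq0 invr_eq0 pnatr_eq0 /= psumr_eq0; last first.
      by move=> ? _; apply: sumr_ge0 => ? _; rewrite mulr_ge0 // -expr2 sqr_ge0.
    move=> /allP/(_ u); rewrite mem_index_enum => /(_ isT).
    rewrite psumr_eq0; last by move=> ? _; rewrite mulr_ge0 // -expr2 sqr_ge0.
    move=> /allP/(_ v); rewrite mem_index_enum => /(_ isT).
    by rewrite -expr2 mulf_eq0 gt_eqF.
  have [u u_gt0|a0] := pickP (fun u => 0 < a u).
    rewrite /dotw (eq_bigr (fun v => h 0 u * (a v * g v))).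
      by rewrite -mulr_sumr g_mean0 mulr0.
    move=> v _; have [->|av_neq0] := eqVneq (a v) 0; first by rewrite !mul0r mulr0.
    have av_gt0 : 0 < a v by rewrite lt0r av_neq0 a_ge0.
    by rewrite (conn _ h0_edge u v) //; ring.
  rewrite /dotw big1 // => u _; have := a0 u.
  by rewrite lt0r a_ge0 andbT => /negbFE/eqP->; rewrite !mul0r.
have term_bounds r : r \in rs -> lam * dotw a (h r) (h r) <= r * dotw a (h r) (h r)
    <= kap * dotw a (h r) (h r).
  move=> r_rs; have [->|dot_neq0] := eqVneq (dotw a (h r) (h r)) 0.
    by rewrite !mulr0 lexx.
  have dot_gt0 : 0 < dotw a (h r) (h r) by rewrite lt0r dot_neq0 dotw_ge0.
  rewrite !ler_pM2r //; apply: bounds (hr r) dot_gt0 _.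
  by apply: contraNneq dot_neq0 => r0; move: r_rs; rewrite r0 => /h0->.
rewrite dot_g energy_g !mulr_sumr.
apply/andP; split; rewrite big_seq [leRHS]big_seq;
  by apply: ler_sum => r /term_bounds/andP[].
Qed.

(** Subtracting the mean leaves the energy unchanged and turns the squared norm
  into the variance.  If the total weight is 0, both sides are 0. *)
Lemma spectral_gap_variance lam kap g : spectral_gap a w lam kap ->
  let var := dotw a g g - (\sum_u a u * g u) ^+ 2 / \sum_u a u in
  lam * var <= energy w g g <= kap * var.
Proof.
move=> gap /=; set s := \sum_u a u * g u; set tot := \sum_u a u.
set var := dotw a g g - s ^+ 2 / tot.
pose c := s / tot; pose g' u := g u - c.
have s_tot : c * tot = s.
  have [tot0|tot_neq0] := eqVneq tot 0; last by rewrite divfK.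
  rewrite tot0 mulr0 /s big1 // => u _; move/eqP: tot0; rewrite psumr_eq0 //.
  by move=> /allP/(_ u); rewrite mem_index_enum => /(_ isT)/eqP->; rewrite mul0r.
have g'_mean0 : \sum_u a u * g' u = 0.
  rewrite (eq_bigr (fun u => a u * g u - a u * c)) => [|u _]; last by rewrite mulrBr.
  by rewrite sumrB -mulr_suml -/s -/tot mulrC s_tot subrr.
have -> : var = dotw a g' g'.
  rewrite /dotw (eq_bigr (fun u =>
    a u * g u * g u - 2 * c * (a u * g u) + c ^+ 2 * a u)).
    rewrite big_split sumrB -!mulr_sumr -/s -/tot /= expr2 -mulrA s_tot.
    by rewrite /var /dotw -[s ^+ 2 / tot]mulrAC -/c; ring.
  by move=> u _; rewrite /g'; ring.
have -> : energy w g g = energy w g' g'.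
  rewrite /energy; congr (_ * _); apply: eq_bigr => u _; apply: eq_bigr => v _.
  by rewrite /g'; ring.
exact: gap.
Qed.

End Gap.
End WeightedGraph.

(** Here [w v] and [T v] are the vertex and edge weights of the link of [v] in a
  two-dimensional complex with vertex weights [a] and edge weights [w].  The
  variances of [g] over the links add up to [(1 - (1 - r)^2) |g|^2]. *)
Lemma spectral_gap_descent (R : realType) (V : finType) (a : V -> R)
    (w : V -> V -> R) (T : V -> V -> V -> R) (lam kap r : R) (g : V -> R) :
  symmetric_weights w -> (forall u, \sum_v w u v = a u) ->
  (forall v u u', 0 <= T v u u') -> (forall v u, \sum_u' T v u u' = w v u) ->
  (forall u u', \sum_v T v u u' = w u u') ->
  0 < lam -> 0 < kap -> (forall v, spectral_gap (w v) (T v) lam kap) ->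
  eigenfun a w r g -> 0 < dotw a g g -> r != 0 ->
  f lam <= r <= f kap.
Proof.
move=> w_sym degE T_ge0 T_deg T_sum lam_gt0 kap_gt0 gaps gr.
set N := dotw a g g => N_gt0 r_neq0.
have mean v : \sum_u w v u * g u = (1 - r) * (a v * g v).
  have := gr v; rewrite (eq_bigr (fun u => w v u * g v - w v u * g u)); last first.
    by move=> u _; rewrite mulrBr.
  rewrite sumrB -mulr_suml degE => e; rewrite mulrBl mul1r -e; ring.
have sum_dot : \sum_v dotw (w v) g g = N.
  rewrite exchange_big; apply: eq_bigr => u _ /=.
  rewrite -!mulr_suml -degE; congr (_ * _ * _).
  by apply: eq_bigr => v _; rewrite w_sym.
have sum_energy : \sum_v energy (T v) g g = r * N.
  rewrite -(energy_eigenfun g w_sym gr) -mulr_sumr; congr (_ * _).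
  rewrite exchange_big; apply: eq_bigr => u _ /=.
  rewrite exchange_big; apply: eq_bigr => u' _ /=.
  by rewrite -mulr_suml T_sum.
pose var v := dotw (w v) g g - (\sum_u w v u * g u) ^+ 2 / \sum_u w v u.
have sum_var : \sum_v var v = (1 - (1 - r) ^+ 2) * N.
  rewrite sumrB sum_dot mulrBl mul1r; congr (_ - _).
  rewrite /N mulr_sumr; apply: eq_bigr => v _; rewrite mean degE.
  have [->|av] := eqVneq (a v) 0; first by rewrite invr0; ring.
  by field.
have bounds v : lam * var v <= energy (T v) g g <= kap * var v.
  exact: (spectral_gap_variance (T_ge0 v) (T_deg v) g (gaps v)).
have lo : lam * ((1 - (1 - r) ^+ 2) * N) <= r * N.
  rewrite -sum_var -sum_energy mulr_sumr; apply: ler_sum => v _.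
  by case/andP: (bounds v).
have hi : r * N <= kap * ((1 - (1 - r) ^+ 2) * N).
  rewrite -sum_var -sum_energy mulr_sumr; apply: ler_sum => v _.
  by case/andP: (bounds v).
have r_gt0 : 0 < r.
  rewrite lt0r r_neq0 -(pmulr_lge0 _ N_gt0) -sum_energy.
  by apply: sumr_ge0 => v _; apply: energy_ge0.
move: lo hi; rewrite !mulrA. rewrite !(ler_pM2r N_gt0).
have -> : 1 - (1 - r) ^+ 2 = (2 - r) * r by ring.
rewrite !mulrA => lo hi.
have {}lo : lam * (2 - r) <= 1 by rewrite -(ler_pM2r r_gt0) mul1r.
have {}hi : 1 <= kap * (2 - r) by rewrite -(ler_pM2r r_gt0) mul1r.
have lam_inv : 2 - r <= 1 / lam by rewrite ler_pdivlMr // mulrC.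
have kap_inv : 1 / kap <= 2 - r by rewrite ler_pdivrMr // mulrC.
by rewrite /f; apply/andP; split; lra.
Qed.

(** * Weights of ordered simplices *)

Section Mass.
Variables (R : realType) (V : finType) (X : {set {set V}}) (m : {set V} -> R).
Implicit Types (l : seq V).

(** Extending the weight by 0 to sequences that are not ordered simplices allows
  all sums to range over all vertices or all tuples. *)
Definition mass l : R :=
  if uniq l && ([set x in l]%SET \in X) then m [set x in l]%SET else 0.

Lemma mass_perm l1 l2 : perm_eq l1 l2 -> mass l1 = mass l2.
Proof.
move=> l12; rewrite /mass (perm_uniq l12).
by have -> : [set x in l1]%SET = [set x in l2]%SET
  by apply/setP=> x; rewrite !inE (perm_mem l12).
Qed.

Lemma mass_swap u v l : mass [:: u, v & l] = mass [:: v, u & l].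
Proof. by apply: mass_perm; rewrite (perm_catCA [:: u] [:: v] l). Qed.

Hypothesis m_gt0 : forall s, s \in X -> 0 < m s.

Lemma mass_ge0 l : 0 <= mass l.
Proof. by rewrite /mass; case: ifP => // /andP[_ /m_gt0/ltW]. Qed.

Lemma mass_gt0 l : (0 < mass l) = uniq l && ([set x in l]%SET \in X).
Proof. by rewrite /mass; case: ifP => [/andP[_ /m_gt0]|]; rewrite ?ltxx. Qed.

Lemma mass_eq0 l : ~~ (0 < mass l) -> mass l = 0.
Proof. by rewrite lt0r mass_ge0 andbT negbK => /eqP. Qed.

Hypothesis X_complex : is_complex X.

Lemma mass_cons_gt0 v l : 0 < mass (v :: l) -> 0 < mass l.
Proof.
case: X_complex => _ down; rewrite !mass_gt0 /= => /andP[/andP[_ ->] /= vlX].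
apply: down vlX _; apply/fintype.subsetP => x; rewrite !inE => ->.
by rewrite orbT.
Qed.

Lemma mass_cons_eq0 v l : mass l = 0 -> mass (v :: l) = 0.
Proof.
move=> l0; apply: mass_eq0; apply: contraNN (@mass_cons_gt0 v l) _.
by rewrite l0 ltxx.
Qed.

(** The simplices with one more vertex than [l] that contain it are the [v |: l]
  with [v] outside of [l], each for a single [v]. *)
Lemma mass_balanced n l : balanced_weight n X m -> (size l <= n)%N ->
  \sum_v mass (v :: l) = mass l.
Proof.
case=> _ bal size_l; have [l_gt0|] := boolP (0 < mass l); last first.
  by move=> /mass_eq0 l0; rewrite l0 big1 // => v _; apply: mass_cons_eq0.
move: (l_gt0); rewrite mass_gt0 => /andP[ul lX]; rewrite [RHS]/mass ul lX /=.
set S := [set x in l]%SET in lX *.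
have card_S : #|S| = size l by rewrite cardsE; apply/card_uniqP.
rewrite -bal ?card_S //.
rewrite (bigID (fun v => (v \notin l) && (v |: S \in X))%SET) /=.
rewrite [X in _ + X]big1 ?addr0; last first.
  by move=> v /negPf vl; rewrite /mass /= ul andbT set_cons vl.
rewrite (partition_big (fun v => v |: S)%SET
  (fun s => (s \in X) && ((#|s| == (size l).+1) && (S \subset s)))) /=; last first.
  move=> v /andP[vl ->] /=; rewrite cardsU1 card_S inE vl add1n eqxx.
  exact: finset.subsetUr.
apply: eq_bigr => s /and3P[sX /eqP card_s Ss].
have /cards1P[v sSv] : #|s :\: S|%SET == 1%N.
  by rewrite cardsD (finset.setIidPr Ss) card_s card_S subSnn.
have vl : v \notin l.
  by move/setP/(_ v): sSv; rewrite !inE eqxx => /andP[].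
have sE : (v |: S = s)%SET.
  by rewrite -sSv finset.setUC -[RHS](finset.setID _ S) (finset.setIidPr Ss).
rewrite (big_pred1 v) => [|u /=].
  by rewrite /mass /= vl ul set_cons -/S sE sX.
apply/idP/eqP => [/andP[/andP[ul' _] /eqP us]|->]; last by rewrite vl sE sX eqxx.
have : u \in (s :\: S)%SET by rewrite !inE ul' -us !inE eqxx.
by rewrite sSv inE => /eqP.
Qed.

End Mass.

Lemma mass_link (R : realType) (V : finType) (X : {set {set V}}) (m : {set V} -> R)
    (t l : seq V) : is_complex X -> uniq t -> [set x in t]%SET \in X ->
  mass (link X [set x in t]%SET) (link_weight m [set x in t]%SET) l =
  mass X m (l ++ t).
Proof.
move=> [_ down] ut tX; rewrite /mass /link_weight.
have -> : [set x in l ++ t]%SET = ([set x in t] :|: [set x in l])%SET.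
  by apply/setP=> x; rewrite !inE mem_cat orbC.
rewrite cat_uniq ut andbT [_ \in link _ _]finset.in_set finset.setUC.
have [lt_X|_] := boolP (_ :|: _ \in X)%SET; last by rewrite !andbF.
rewrite (down _ _ lt_X) ?finset.subsetUr //= !andbT.
congr (if _ && _ then _ else _); rewrite -all_predC -finset.setI_eq0.
apply/eqP/allP => [disj x xt|disj].
  by apply/negP=> xl; move/setP/(_ x): disj; rewrite !inE xt [x \in l]xl.
apply/setP=> x; rewrite !inE; apply/negP => /andP[xl xt].
by have /negP := disj x xt.
Qed.

(** * Alternating sums over faces *)

Section TupleSums.
Variables (R : comNzRingType) (V : finType).

Lemma sum_tuple0 (F : 0.-tuple V -> R) : \sum_t F t = F [tuple].
Proof.
by rewrite (big_pred1 [tuple]) // => t; apply/esym/eqP; rewrite [LHS]tuple0.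
Qed.

Lemma sum_tuple_cons p (F : p.+1.-tuple V -> R) :
  \sum_t F t = \sum_v \sum_(s : p.-tuple V) F (cons_tuple v s).
Proof.
rewrite pair_big /= (reindex (fun vs : V * p.-tuple V => cons_tuple vs.1 vs.2)) //=.
exists (fun t => (thead t, [tuple of behead t])) => [[v s] _|t _] /=.
  by rewrite theadE; congr (_, _); apply: val_inj.
by rewrite [RHS]tuple_eta; apply: val_inj.
Qed.

Lemma tnth_cons0 p v (s : p.-tuple V) : tnth (cons_tuple v s) ord0 = v.
Proof. by rewrite (tnth_nth v). Qed.

Lemma tnth_consS p v (s : p.-tuple V) i :
  tnth (cons_tuple v s) (lift ord0 i) = tnth s i.
Proof. by rewrite !(tnth_nth v). Qed.

Lemma face0_cons p v (s : p.-tuple V) : face ord0 (cons_tuple v s) = s.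
Proof. by apply: eq_from_tnth => j; rewrite tnth_mktuple tnth_consS. Qed.

Lemma faceS_cons p v (i : 'I_p.+1) (s : p.+1.-tuple V) :
  face (lift ord0 i) (cons_tuple v s) = cons_tuple v (face i s).
Proof.
apply: eq_from_tnth => j; rewrite tnth_mktuple.
case: (unliftP ord0 j) => [k ->|->].
  rewrite tnth_consS tnth_mktuple -[RHS](tnth_consS v); congr tnth.
  by apply: val_inj; rewrite /= /bump /= !add1n ltnS addnS.
rewrite tnth_cons0 -[RHS](tnth_cons0 v s); congr tnth.
exact: val_inj.
Qed.

Lemma permute_cons p (g : 'S_p) v (s : p.-tuple V) :
  cons_tuple v (permute g s) = permute (lift_perm ord0 ord0 g) (cons_tuple v s).
Proof.
apply: eq_from_tnth => j; rewrite tnth_mktuple.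
case: (unliftP ord0 j) => [k ->|->].
  by rewrite lift_perm_lift !tnth_consS tnth_mktuple.
by rewrite lift_perm_id !tnth_cons0.
Qed.

Definition antisymmetric_fun p (G : p.-tuple V -> R) :=
  forall (g : 'S_p) t, G (permute g t) = (-1) ^+ odd_perm g * G t.

Lemma antisymmetric_cons p (G : p.+1.-tuple V -> R) v :
  antisymmetric_fun G ->
  antisymmetric_fun (fun s : p.-tuple V => G (cons_tuple v s)).
Proof. by move=> Ga g t; rewrite permute_cons Ga odd_lift_perm. Qed.

Lemma antisymmetric_swap p (G : p.+2.-tuple V -> R) u v (s : p.-tuple V) :
  antisymmetric_fun G ->
  G (cons_tuple u (cons_tuple v s)) = - G (cons_tuple v (cons_tuple u s)).
Proof.
move=> Ga; pose g : 'S_p.+2 := tperm ord0 (lift ord0 ord0).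
have -> : cons_tuple u (cons_tuple v s) = permute g (cons_tuple v (cons_tuple u s)).
  apply: eq_from_tnth => j; rewrite tnth_mktuple.
  case: (unliftP ord0 j) => [j' ->|->]; last first.
    by rewrite tpermL tnth_consS !tnth_cons0.
  case: (unliftP ord0 j') => [k ->|->]; last first.
    by rewrite tpermR tnth_consS !tnth_cons0.
  rewrite tpermD ?(inj_eq lift_inj) ?neq_lift //.
  by rewrite !tnth_consS.
by rewrite Ga odd_tperm neq_lift expr1 mulN1r.
Qed.

(** Moving the vertex [i] of a tuple to the front turns its face [i] into its
  tail, and multiplies an antisymmetric function by [(-1) ^+ i]: the [p.+1]
  terms of the alternating sum contribute equally. *)
Lemma sum_face_antisymmetric p (psi : p.-tuple V -> R) (G : p.+1.-tuple V -> R) :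
  antisymmetric_fun G ->
  \sum_t (\sum_(i < p.+1) (-1) ^+ i * psi (face i t)) * G t =
  p.+1%:R * \sum_v \sum_(s : p.-tuple V) psi s * G (cons_tuple v s).
Proof.
move=> Ga; under eq_bigr do rewrite mulr_suml.
rewrite exchange_big /= mulr_natl -[X in _ *+ X]card_ord -sumr_const.
apply: eq_bigr => i _; pose g : 'S_p.+1 := lift_perm i ord0 1%g.
have g_bij : bijective (@permute V p.+1 g).
  exists (@permute V p.+1 g^-1%g) => t; apply: eq_from_tnth => j;
    by rewrite !tnth_mktuple ?permK ?permKV.
rewrite (reindex _ (onW_bij _ g_bij)) /= sum_tuple_cons.
apply: eq_bigr => v _; apply: eq_bigr => s _.
have -> : face i (permute g (cons_tuple v s)) = s.
  by apply: eq_from_tnth => j; rewrite !tnth_mktuple lift_perm_lift perm1 tnth_consS.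
rewrite Ga odd_lift_perm odd_perm1 addbF /= addbF signr_odd.
by rewrite mulrACA -exprD addnn -mul2n exprM sqrrN expr1n expr1n mul1r.
Qed.
End TupleSums.

(** * The cochain complex and its inner product *)

Section InnerMass.
Variables (R : realType) (V : finType) (X : {set {set V}}) (m : {set V} -> R).
Hypothesis m_gt0 : forall s, s \in X -> 0 < m s.

Lemma mass_tupleE p (t : p.-tuple V) :
  mass X m t = if ordered_simplex X t then m (supp t) else 0.
Proof. by []. Qed.

Lemma mass_tuple_gt0 p (t : p.-tuple V) : (0 < mass X m t) = ordered_simplex X t.
Proof. exact: mass_gt0. Qed.

Lemma innerE p (phi psi : C R X p) :
  inner m phi psi =
  (p`!)%:R^-1 * \sum_(t : p.-tuple V) mass X m t * (vsval phi t * vsval psi t).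
Proof.
rewrite /inner big_mkcond mulr_sumr; apply: eq_bigr => t _ /=.
rewrite mass_tupleE; case: (ordered_simplex X t); last by rewrite mul0r mulr0.
by rewrite [m _ / _]mulrC -mulrA.
Qed.

Lemma innerC p (phi psi : C R X p) : inner m phi psi = inner m psi phi.
Proof. by apply: eq_bigr => t _; rewrite [X in _ * X]mulrC. Qed.

Lemma innerZr p c (phi psi : C R X p) : inner m phi (c *: psi) = c * inner m phi psi.
Proof.
rewrite mulr_sumr; apply: eq_bigr => t _; rewrite !ffunE.
by rewrite /GRing.scale /=; ring.
Qed.

Lemma innerBr p (phi psi chi : C R X p) :
  inner m phi (psi - chi) = inner m phi psi - inner m phi chi.
Proof. by rewrite -sumrB; apply: eq_bigr => t _; rewrite !ffunE; ring. Qed.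

Lemma inner_gt0 p (phi : C R X p) : phi != 0 -> 0 < inner m phi phi.
Proof.
have term_ge0 (t : p.-tuple V) : 0 <= mass X m t * (vsval phi t * vsval phi t).
  by rewrite mulr_ge0 ?mass_ge0 // -expr2 sqr_ge0.
move=> phi_neq0; rewrite innerE mulr_gt0 ?invr_gt0 ?ltr0n ?fact_gt0 //.
rewrite lt0r sumr_ge0 ?andbT //; apply: contraNneq phi_neq0 => /eqP.
rewrite psumr_eq0 // => /allP phi0; apply/eqP/subvs_inj/ffunP => t.
rewrite [RHS]ffunE; have /cochainP[off _] := subvsP phi.
have [Xt|/off //] := boolP (ordered_simplex X t).
have := phi0 t; rewrite mem_index_enum => /(_ isT).
rewrite mulf_eq0 gt_eqF ?mass_tuple_gt0 //=.
by rewrite -expr2 sqrf_eq0 => /eqP.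
Qed.

Lemma inner_injr p (phi psi : C R X p) :
  (forall chi, inner m chi phi = inner m chi psi) -> phi = psi.
Proof.
move=> e; apply/eqP; rewrite -subr_eq0; apply/negPn/negP => /inner_gt0.
by rewrite innerBr e subrr ltxx.
Qed.

Lemma cochain_antisymmetric p (phi : C R X p) : antisymmetric_fun (vsval phi).
Proof. by case/cochainP: (subvsP phi). Qed.

Lemma mass_permute p (g : 'S_p) (t : p.-tuple V) :
  mass X m (permute g t) = mass X m t.
Proof. by rewrite !mass_tupleE ordered_simplex_permute supp_permute. Qed.

Lemma antisymmetric_mass p (G : p.-tuple V -> R) :
  antisymmetric_fun G -> antisymmetric_fun (fun t => mass X m t * G t).
Proof. by move=> Ga g t; rewrite mass_permute Ga mulrCA. Qed.

Lemma mass_diff p (phi : C R X p) (t : p.+1.-tuple V) :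
  mass X m t * vsval (diff R X p phi) t =
  mass X m t * \sum_(i < p.+1) (-1) ^+ i * vsval phi (face i t).
Proof. by rewrite diffE ffunE mass_tupleE; case: ifP; rewrite ?mul0r. Qed.

(** This computes the adjoint: up to normalization, the codifferential of [chi]
  at [s] is the sum over [v] of the [m(vs) chi(vs)]. *)
Lemma inner_diff p (psi : C R X p) (chi : C R X p.+1) :
  (p`!)%:R * inner m (diff R X p psi) chi =
  \sum_v \sum_(s : p.-tuple V)
    vsval psi s * (mass X m (v :: s) * vsval chi (cons_tuple v s)).
Proof.
rewrite innerE (eq_bigr (fun t =>
    (\sum_(i < p.+1) (-1) ^+ i * vsval psi (face i t)) *
    (mass X m t * vsval chi t))); last first.
  by move=> t _; rewrite mulrA mass_diff; ring.
rewrite (sum_face_antisymmetric _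
  (antisymmetric_mass (@cochain_antisymmetric _ chi))) factS natrM.
have : p.+1%:R != 0 :> R by rewrite pnatr_eq0.
have : (p`!)%:R != 0 :> R by rewrite pnatr_eq0 -lt0n fact_gt0.
move: (p.+1%:R) (p`!%:R) => c d d_neq0 c_neq0.
by field; apply/andP.
Qed.

Lemma mass_cons_diff p (psi : C R X p) v (s : p.+1.-tuple V) : is_complex X ->
  mass X m (v :: s) * vsval (diff R X p psi) s =
  mass X m (v :: s) * \sum_(i < p.+1) (-1) ^+ i * vsval psi (face i s).
Proof.
move=> X_complex; have [vs_gt0|] := boolP (0 < mass X m (v :: s)); last first.
  by move=> /(mass_eq0 m_gt0)->; rewrite !mul0r.
have s_gt0 := mass_cons_gt0 m_gt0 X_complex vs_gt0.
by congr (_ * _); apply: (mulfI (lt0r_neq0 s_gt0)); exact: mass_diff.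
Qed.
End InnerMass.

(** Pairing with an arbitrary [chi] and applying the previous formula twice gives
  a sum over [v], [u] and [s] of terms [psi(s) chi(vus)] that are antisymmetric
  in [u] and [v].  The pairing is taken for the constant weight 1. *)
Lemma diff_diff (R : realType) (V : finType) (X : {set {set V}}) p (psi : C R X p) :
  is_complex X -> diff R X p.+1 (diff R X p psi) = 0.
Proof.
move=> X_complex; pose m (s : {set V}) : R := 1.
have m_gt0 s : s \in X -> 0 < m s by rewrite ltr01.
apply: (inner_injr m_gt0) => chi.
rewrite -[in RHS](scale0r chi) innerZr mul0r innerC.
apply: (@mulfI _ (p.+1`!)%:R); first by rewrite pnatr_eq0 -lt0n fact_gt0.
rewrite mulr0 inner_diff.
pose G v u (s : p.-tuple V) :=
  mass X m (v :: u :: s) * vsval chi (cons_tuple v (cons_tuple u s)).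
have -> : \sum_v \sum_(s : p.+1.-tuple V) vsval (diff R X p psi) s *
      (mass X m (v :: s) * vsval chi (cons_tuple v s)) =
    p.+1%:R * \sum_v \sum_u \sum_(s : p.-tuple V) vsval psi s * G v u s.
  rewrite mulr_sumr; apply: eq_bigr => v _.
  rewrite -(sum_face_antisymmetric _ (antisymmetric_cons v
    (antisymmetric_mass X m (@cochain_antisymmetric _ _ _ _ chi)))).
  apply: eq_bigr => s _; rewrite mulrA [_ * mass _ _ _]mulrC mass_cons_diff //.
  by rewrite -mulrA mulrCA.
have : \sum_v \sum_u \sum_(s : p.-tuple V) vsval psi s * G v u s =
    - \sum_v \sum_u \sum_(s : p.-tuple V) vsval psi s * G v u s.
  rewrite {1}exchange_big -sumrN; apply: eq_bigr => v _ /=.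
  rewrite -sumrN; apply: eq_bigr => u _; rewrite -sumrN; apply: eq_bigr => s _.
  rewrite /G mass_swap.
  rewrite (antisymmetric_swap u v s (@cochain_antisymmetric _ _ _ _ chi)).
  by rewrite !mulrN.
by move=> S0; rewrite (_ : \sum_v _ = 0) ?mulr0 //; lra.
Qed.

(** * Laplacians and links *)

Section Laplacian.
Variables (R : realType) (V : finType) (X : {set {set V}}) (m : {set V} -> R).
Hypothesis m_gt0 : forall s, s \in X -> 0 < m s.
Hypothesis X_complex : is_complex X.

(** [vertex_mass l] and [edge_mass l] are the weighted graph underlying the link
  of [l]. *)
Definition vertex_mass (l : seq V) : V -> R := fun u => mass X m (u :: l).
Definition edge_mass (l : seq V) : V -> V -> R := fun u v => mass X m [:: u, v & l].

Lemma edge_mass_sym l : symmetric_weights (edge_mass l).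
Proof. by move=> u v; apply: mass_swap. Qed.

Lemma inner_laplacian_up k (phi psi : C R X k.+1) :
  inner m psi (laplacian_up X m k phi) =
  inner m (diff R X k.+1 psi) (diff R X k.+1 phi).
Proof. by rewrite comp_lfunE -codiffP. Qed.

Lemma inner0l p (phi : C R X p) : inner m 0 phi = 0.
Proof. by rewrite innerC -(scale0r phi) innerZr mul0r. Qed.

Definition vertex_cochain (g : V -> R) : tuple_fun R V 1 :=
  [ffun t => if ordered_simplex X t then g (thead t) else 0].

Lemma vertex_cochainP g : vertex_cochain g \in cochain R X 1.
Proof.
apply/cochainP; split=> [t /negPf tX|s t]; first by rewrite ffunE tX.
rewrite !ffunE ordered_simplex_permute permS1 odd_perm1 mul1r.
by rewrite /thead tnth_mktuple perm1.
Qed.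

(** On functions of vertices, [inner m (diff psi) (diff phi)] is the energy of the
  graph, so an eigenfunction of the graph is a weak eigenvector of the
  Laplacian. *)
Lemma eigenfun_spec r g : eigenfun (vertex_mass [::]) (edge_mass [::]) r g ->
  0 < dotw (vertex_mass [::]) g g -> spec (laplacian_up X m 0) r.
Proof.
move=> gr g_gt0; pose phi : C R X 1 := vsproj (cochain R X 1) (vertex_cochain g).
have phiE u : 0 < mass X m [:: u] -> vsval phi [tuple u] = g u.
  move=> u_gt0; rewrite vsprojK ?vertex_cochainP // ffunE.
  by rewrite -(mass_tuple_gt0 m_gt0) u_gt0.
apply/specP; exists phi.
  apply: contraTneq g_gt0 => phi0; rewrite -leNgt /dotw big1 // => u _.
  have [u_gt0|] := boolP (0 < vertex_mass [::] u).
    by rewrite -phiE // phi0 !ffunE !mulr0.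
  by move=> /(mass_eq0 m_gt0) e; rewrite [X in X * _ * _]e !mul0r.
apply: (inner_injr m_gt0) => psi; rewrite inner_laplacian_up innerZr.
pose h u := vsval psi [tuple u].
have -> : inner m psi phi = dotw (vertex_mass [::]) g h.
  rewrite innerE invr1 mul1r sum_tuple_cons; apply: eq_bigr => u _.
  rewrite sum_tuple0 -mulrA.
  have -> : cons_tuple u [tuple] = [tuple u] by apply: val_inj.
  have [u_gt0|] := boolP (0 < vertex_mass [::] u).
    by rewrite phiE // [_ * g u]mulrC.
  by rewrite /vertex_mass => /(mass_eq0 m_gt0)->; rewrite !mul0r.
rewrite -(energy_eigenfun _ (edge_mass_sym _) gr) innerE /energy; congr (_ * _).
rewrite sum_tuple_cons; apply: eq_bigr => u _; rewrite sum_tuple_cons.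
apply: eq_bigr => v _; rewrite sum_tuple0.
set t := cons_tuple u _; rewrite -[mass X m t]/(edge_mass [::] u v).
have [t_gt0|] := boolP (0 < edge_mass [::] u v); last first.
  by move=> /(mass_eq0 m_gt0) e; rewrite [edge_mass _ _ _]e !mul0r.
congr (_ * _).
have dE (chi : C R X 1) :
    vsval (diff R X 1 chi) t = vsval chi [tuple v] - vsval chi [tuple u].
  rewrite diffE ffunE -(mass_tuple_gt0 m_gt0) [0 < _]t_gt0.
  rewrite !big_ord_recl big_ord0 expr0 mul1r addr0 expr1 mulN1r.
  rewrite faceS_cons !face0_cons.
  by congr (vsval chi _ - vsval chi _); apply: val_inj.
rewrite !dE !phiE -?/(h _).
- ring.
- by apply: (mass_cons_gt0 m_gt0 X_complex (v := v)); rewrite mass_swap.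
- exact: (mass_cons_gt0 m_gt0 X_complex t_gt0).
Qed.

Section Garland.
Variables (n k : nat) (phi : C R X k.+1).
Hypothesis m_balanced : balanced_weight n X m.
Hypothesis k_lt_n : (k < n)%N.

Definition localization (s : k.-tuple V) (u : V) : R := vsval phi (cons_tuple u s).
Local Notation loc := localization.

Lemma sum_dotw_localization :
  \sum_(s : k.-tuple V) dotw (vertex_mass s) (loc s) (loc s) =
  k.+1`!%:R * inner m phi phi.
Proof.
rewrite innerE mulVKf ?pnatr_eq0 -?lt0n ?fact_gt0 // sum_tuple_cons exchange_big /=.
by apply: eq_bigr => u _; apply: eq_bigr => s _; rewrite mulrA.
Qed.

(** In both norms the diagonal terms give multiples of [|phi|^2], thanks to
  balancedness.  The cross terms [phi(us) phi(vs)] are subtracted once in the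
  sum of the energies, and [k + 1] times in the expansion of
  [(k + 1)! |d phi|^2], so eliminating them expresses one by the other. *)
Lemma sum_energy_localization :
  \sum_(s : k.-tuple V) energy (edge_mass s) (loc s) (loc s) =
  k`!%:R * (inner m (diff R X k.+1 phi) (diff R X k.+1 phi) +
            k%:R * inner m phi phi).
Proof.
pose cross := \sum_(v : V) \sum_(u : V) \sum_(s : k.-tuple V)
  mass X m [:: v, u & s] * (loc s u * loc s v).
have energyD : \sum_(s : k.-tuple V) energy (edge_mass s) (loc s) (loc s) =
    k.+1`!%:R * inner m phi phi - cross.
  rewrite -sum_dotw_localization /cross.
  under [X in _ - X]eq_bigr do rewrite exchange_big /=.
  rewrite [X in _ - X]exchange_big -sumrB; apply: eq_bigr => s _ /=.
  rewrite energyE; last exact: edge_mass_sym.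
  rewrite /dotw -sumrB; apply: eq_bigr => u _.
  rewrite (eq_bigr (fun v =>
    mass X m [:: v, u & s] * loc s u - edge_mass s u v * loc s v)).
    rewrite sumrB -mulr_suml (mass_balanced m_gt0 X_complex m_balanced); last first.
      by rewrite /= size_tuple.
    rewrite mulrBr mulr_sumr; congr (_ - _); first by rewrite /vertex_mass; ring.
    by apply: eq_bigr => v _; rewrite /edge_mass; ring.
  by move=> v _; rewrite mulrBr [mass _ _ _]mass_swap.
have normD : k.+1`!%:R * inner m (diff R X k.+1 phi) (diff R X k.+1 phi) =
    k.+1`!%:R * inner m phi phi - k.+1%:R * cross.
  rewrite inner_diff // [inner m phi phi]innerE.
  rewrite mulVKf ?pnatr_eq0 -?lt0n ?fact_gt0 //.
  rewrite /cross mulr_sumr.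
  have -> : \sum_(s : k.+1.-tuple V) mass X m s * (vsval phi s * vsval phi s) =
      \sum_v \sum_(s : k.+1.-tuple V)
        mass X m (v :: s) * (vsval phi s * vsval phi s).
    rewrite exchange_big; apply: eq_bigr => s _ /=.
    by rewrite -mulr_suml (mass_balanced m_gt0 X_complex m_balanced) // size_tuple.
  rewrite -sumrB; apply: eq_bigr => v _.
  have Ga : antisymmetric_fun
      (fun s : k.+1.-tuple V => mass X m (v :: s) * vsval phi s).
    move=> g s; have := mass_permute X m (lift_perm ord0 ord0 g) (cons_tuple v s).
    by rewrite -permute_cons /= => ->; rewrite cochain_antisymmetric mulrCA.
  have faces := sum_face_antisymmetric (fun s => vsval phi (cons_tuple v s)) Ga.
  rewrite (eq_bigr (fun u => \sum_(s : k.-tuple V) vsval phi (cons_tuple v s) *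
    (mass X m [:: v, u & s] * vsval phi (cons_tuple u s)))); last first.
    by move=> u _; apply: eq_bigr => s _; rewrite /loc; ring.
  rewrite -[X in _ - X]faces -sumrB; apply: eq_bigr => s _.
  have := mass_diff m phi (cons_tuple v s).
  rewrite big_ord_recl face0_cons expr0 mul1r /= => ->.
  rewrite (eq_bigr (fun i : 'I_k.+1 =>
    - ((-1) ^+ i * vsval phi (cons_tuple v (face i s))))).
    by rewrite sumrN; ring.
  by move=> i _; rewrite faceS_cons /bump add1n exprS mulN1r mulNr.
have k_neq0 : k.+1%:R != 0 :> R by rewrite pnatr_eq0.
have {}normD : k`!%:R * inner m (diff R X k.+1 phi) (diff R X k.+1 phi) =
    k`!%:R * inner m phi phi - cross.
  by apply: (mulfI k_neq0); rewrite mulrBr !mulrA -natrM -factS normD.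
by rewrite energyD mulrDr normD factS natrM -natr1; ring.
Qed.

(** The means [psi s] of the localizations form, up to normalization, the
  codifferential of [phi].  The sum of their squares is proportional to the
  product of [d psi] and [phi], which is [r^-1] times that of [d (d psi)] and
  [d phi]. *)
Lemma localization_mean0 r : laplacian_up X m k phi = r *: phi -> r != 0 ->
  forall s : k.-tuple V, \sum_u vertex_mass s u * loc s u = 0.
Proof.
move=> lap r_neq0.
pose psif : tuple_fun R V k :=
  [ffun s : k.-tuple V => \sum_u vertex_mass s u * loc s u].
have psiP : psif \in cochain R X k.
  apply/cochainP; split=> [s sX|g s]; rewrite !ffunE.
    rewrite big1 // => u _; rewrite /vertex_mass (mass_cons_eq0 m_gt0) ?mul0r //.
    by apply: mass_eq0; rewrite // (mass_tuple_gt0 m_gt0).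
  rewrite mulr_sumr; apply: eq_bigr => u _.
  exact: (antisymmetric_cons u
    (antisymmetric_mass X m (@cochain_antisymmetric _ _ _ _ phi))).
pose psi : C R X k := vsproj (cochain R X k) psif.
have psiE s : vsval psi s = \sum_u vertex_mass s u * loc s u.
  by rewrite vsprojK // ffunE.
have dpsi_phi : inner m (diff R X k psi) phi = 0.
  apply: (mulfI r_neq0); rewrite mulr0 -innerZr -lap inner_laplacian_up.
  by rewrite diff_diff // inner0l.
have : \sum_(s : k.-tuple V) (\sum_u vertex_mass s u * loc s u) ^+ 2 = 0.
  have := inner_diff m psi phi; rewrite dpsi_phi mulr0 exchange_big => /esym.
  by apply: etrans; apply: eq_bigr => s _ /=; rewrite -mulr_sumr psiE expr2.
move=> /eqP; rewrite psumr_eq0 => [/allP psi0 s|s _]; last exact: sqr_ge0.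
by have := psi0 s; rewrite mem_index_enum => /(_ isT); rewrite sqrf_eq0 => /eqP.
Qed.

Lemma garland_bounds lam kap r :
  (forall s : k.-tuple V, spectral_gap (vertex_mass s) (edge_mass s) lam kap) ->
  laplacian_up X m k phi = r *: phi -> phi != 0 -> r != 0 ->
  k.+1%:R * lam - k%:R <= r <= k.+1%:R * kap - k%:R.
Proof.
move=> gaps lap phi_neq0 r_neq0.
have phi_gt0 := inner_gt0 m_gt0 phi_neq0; set N := inner m phi phi in phi_gt0.
have fact_k_gt0 : 0 < k`!%:R :> R by rewrite ltr0n fact_gt0.
have energyN : \sum_(s : k.-tuple V) energy (edge_mass s) (loc s) (loc s) =
    k`!%:R * ((r + k%:R) * N).
  by rewrite sum_energy_localization -inner_laplacian_up lap innerZr -mulrDl.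
have bounds (s : k.-tuple V) := gaps s _ (localization_mean0 lap r_neq0 s).
have lo : lam * (k.+1`!%:R * N) <= k`!%:R * ((r + k%:R) * N).
  rewrite -sum_dotw_localization -energyN mulr_sumr; apply: ler_sum => s _.
  by case/andP: (bounds s).
have hi : k`!%:R * ((r + k%:R) * N) <= kap * (k.+1`!%:R * N).
  rewrite -sum_dotw_localization -energyN mulr_sumr; apply: ler_sum => s _.
  by case/andP: (bounds s).
move: lo hi; rewrite factS natrM [_ * k`!%:R]mulrC -!mulrA ![_ * (k`!%:R * _)]mulrCA.
rewrite !(ler_pM2l fact_k_gt0) !mulrA !(ler_pM2r phi_gt0) => lo hi.
by rewrite lerBlDr lerBrDr mulrC lo mulrC hi.
Qed.


End Garland.
End Laplacian.

(** * From the one-dimensional links to all links *)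

Section Links.
Variables (R : realType) (V : finType) (X : {set {set V}}) (m : {set V} -> R).
Hypothesis m_gt0 : forall s, s \in X -> 0 < m s.
Hypothesis X_complex : is_complex X.

Lemma link_complex (S : {set V}) : S \in X -> is_complex (link X S).
Proof.
case: X_complex => X0 down SX; split=> [|s t]; rewrite !finset.in_set.
  by rewrite X0 finset.set0U SX finset.disjoints_subset finset.sub0set.
move=> /and3P[tX tS tSX] st; apply/and3P; split.
- exact: down tX st.
- by apply: disjointWl tS; apply/fintype.subsetP=> x xs; apply: (fintype.subsetP st).
- by apply: down tSX _; apply: finset.setSU.
Qed.

Lemma link_weight_gt0 (S : {set V}) s : s \in link X S -> 0 < link_weight m S s.
Proof.
by rewrite finset.in_set => /and3P[_ _ sSX]; rewrite m_gt0 // finset.setUC.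
Qed.

Lemma complex_dim_link n (S : {set V}) :
  pure n X -> S \in X -> (#|S| < n)%N -> (0 < complex_dim (link X S))%N.
Proof.
case: X_complex => _ down X_pure SX S_lt; have [t [tX St card_t]] := X_pure S SX.
have tS_link : (t :\: S)%SET \in link X S.
  rewrite finset.in_set; apply/and3P; split.
  - exact: down tX (finset.subsetDl _ _).
  - by rewrite finset.disjoints_subset finset.setDE finset.subsetIr.
  - by apply: down tX _; rewrite finset.subUset finset.subsetDl.
have := @leq_bigmax_cond _ (fun s => s \in link X S)
  (fun s : {set V} => #|s|) _ tS_link.
rewrite cardsD (finset.setIidPr St) card_t /complex_dim => le_max.
lia.
Qed.

Lemma vertex_mass_link t : uniq t -> [set x in t]%SET \in X ->
  vertex_mass (link X [set x in t]%SET) (link_weight m [set x in t]%SET) [::] =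
  vertex_mass X m t.
Proof. by move=> ut tX; apply/funext => u; apply: mass_link. Qed.

Lemma edge_mass_link t : uniq t -> [set x in t]%SET \in X ->
  edge_mass (link X [set x in t]%SET) (link_weight m [set x in t]%SET) [::] =
  edge_mass X m t.
Proof. by move=> ut tX; apply/funext => u; apply/funext => v; apply: mass_link. Qed.

Lemma link_connected_weights t : uniq t -> [set x in t]%SET \in X ->
  connected (link X [set x in t]%SET) ->
  connected_weights (vertex_mass X m t) (edge_mass X m t).
Proof.
move=> ut tX conn h h_edge u v.
rewrite -(vertex_mass_link ut tX) !(mass_gt0 (@link_weight_gt0 _)) /= => uX vX.
have vertexE x : [set y in [:: x]]%SET = [set x]%SET.
  by apply/setP=> y; rewrite !inE.
rewrite !vertexE in uX vX; have /connectP[p] := conn u v uX vX.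
elim: p u {uX} => [|x p IHp] u /= => [_ -> //|/andP[/andP[ux uxX] xp] v_last].
rewrite (h_edge u x); first exact: IHp xp v_last.
rewrite -(edge_mass_link ut tX) (mass_gt0 (@link_weight_gt0 _)) /= inE ux.
have -> : [set y in [:: u; x]]%SET = [set u; x]%SET by apply/setP=> y; rewrite !inE.
exact: uxX.
Qed.

Lemma edge_mass_ge0 l u v : 0 <= edge_mass X m l u v.
Proof. exact: mass_ge0. Qed.

Lemma sum_edge_mass n l u : balanced_weight n X m -> (size l < n)%N ->
  \sum_v edge_mass X m l u v = vertex_mass X m l u.
Proof.
move=> bal l_lt; rewrite (eq_bigr _ (fun v _ => mass_swap X m u v l)).
exact: mass_balanced bal _.
Qed.

Lemma spectral_gap_null l lam kap : mass X m l = 0 ->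
  spectral_gap (vertex_mass X m l) (edge_mass X m l) lam kap.
Proof.
move=> l0; have cons0 := mass_cons_eq0 m_gt0 X_complex.
move=> g _; have -> : dotw (vertex_mass X m l) g g = 0.
  by apply: big1 => u _; rewrite /vertex_mass cons0 // !mul0r.
rewrite !mulr0 /energy big1 ?mulr0 ?lexx // => u _.
by apply: big1 => v _; rewrite /edge_mass !cons0 // mul0r.
Qed.

End Links.

(** The lower bound [(n - j - 1) / (n - j)] is the image under [f] of the one
  for [j - 1]. *)
Lemma iter_f_bounds (R : realType) n (lam kap : R) j : (j < n)%N ->
  (n%:R - 1) / n%:R < lam -> lam <= kap ->
  (n - j.+1)%:R / (n - j)%:R < iter j (@f R) lam <= iter j (@f R) kap.
Proof.
move=> j_lt lam_gt lam_kap; elim: j j_lt => [|j IHj] j_lt.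
  by rewrite subn0 natrB // lam_gt.
have /andP[] := IHj (ltnW j_lt); set x := iter j _ lam; set y := iter j _ kap.
have [d dE] : exists d, (n - j.+1)%N = d.+1 by exists (n - j.+1).-1; lia.
have -> : (n - j)%N = d.+2 by lia.
have -> : (n - j.+2)%N = d by lia.
rewrite dE !iterS -/x -/y => x_gt xy.
have x_gt0 : 0 < x by apply: lt_trans x_gt; rewrite divr_gt0 ?ltr0n.
have inv_yx : 1 / y <= 1 / x by rewrite !mul1r lef_pV2 ?posrE // (lt_le_trans x_gt0).
have inv_x : 1 / x < d.+2%:R / d.+1%:R.
  by rewrite mul1r -[ltRHS]invf_div ltf_pV2 ?posrE // divr_gt0 ?ltr0n.
have e : d.+2%:R / d.+1%:R = 2 - d%:R / d.+1%:R :> R.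
  have d1_neq0 : d.+1%:R != 0 :> R by rewrite pnatr_eq0.
  by apply: (mulIf d1_neq0); rewrite mulrBl !divfK // -!natr1; ring.
rewrite e in inv_x.
by rewrite /f ltrBrDr -ltrBrDl inv_x lerD2l lerN2.
Qed.

(** Induction on the codimension: the base case is the hypothesis on the spectra,
  and the step is the descent from the sequences [v :: l] to [l].  Sequences
  that are not ordered simplices have the weight 0 everywhere, hence trivially
  any gap. *)
Lemma spectral_gap_of_local_spectrum (R : realType) (V : finType) (n : nat)
    (X : {set {set V}}) (m : {set V} -> R) (lam kap : R) :
  (1 < n)%N -> is_complex X -> pure n X -> balanced_weight n X m ->
  (forall t : {set V}, t \in X -> (0 < complex_dim (link X t))%N ->
     connected (link X t)) ->
  lam <= kap -> (n%:R - 1) / n%:R < lam ->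
  (forall t : (n.-1).-tuple V, ordered_simplex X t -> forall r, r != 0 ->
     spec (laplacian_up (link X (supp t)) (link_weight m (supp t)) 0) r ->
     lam <= r <= kap) ->
  forall j (l : seq V), (j <= n.-1)%N -> size l = (n.-1 - j)%N ->
  spectral_gap (vertex_mass X m l) (edge_mass X m l)
    (iter j (@f R) lam) (iter j (@f R) kap).
Proof.
move=> n_gt1 X_complex X_pure m_bal conn lam_kap lam_gt local.
have m_gt0 := m_bal.1.
have gap_of_bounds l lo hi : (size l < n)%N ->
    (0 < mass X m l ->
      forall r g, eigenfun (vertex_mass X m l) (edge_mass X m l) r g ->
      0 < dotw (vertex_mass X m l) g g -> r != 0 -> lo <= r <= hi) ->
    spectral_gap (vertex_mass X m l) (edge_mass X m l) lo hi.
  move=> l_lt bounds; have [l_gt0|] := boolP (0 < mass X m l); last first.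
    by move=> /(mass_eq0 m_gt0); apply: spectral_gap_null.
  move: (l_gt0); rewrite mass_gt0 // => /andP[ul lX].
  apply: spectral_gap_of_eigen => [|u v|u||]; last exact: bounds.
  - exact: edge_mass_sym.
  - exact: edge_mass_ge0.
  - exact: sum_edge_mass m_bal l_lt.
  - apply: link_connected_weights => //; apply: conn => //.
    by apply: complex_dim_link X_pure lX _; rewrite // cardsE (card_uniqP ul).
(* The one-dimensional links carry the hypothesis [local]; [eigenfun_spec] is
   applied in the link itself, seen as a complex with the empty sequence. *)
elim=> [|j IHj] l j_le size_l; apply: gap_of_bounds; rewrite ?size_l; try lia.
  rewrite subn0 in size_l; move=> l_gt0 r g gr g_gt0 r_neq0.
  move: l_gt0; rewrite mass_gt0 // => /andP[ul lX].
  have tP : size l == n.-1 by rewrite size_l.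
  apply: (local (Tuple tP)) r_neq0 _; first exact/andP.
  apply: (@eigenfun_spec _ _ _ _ _ _ r g).
  - exact: link_weight_gt0.
  - exact: link_complex.
  - by rewrite vertex_mass_link ?edge_mass_link.
  - by rewrite vertex_mass_link.
move=> _ r g gr g_gt0 r_neq0.
have j_lt : (j < n)%N by lia.
have /andP[x_gt xy] := iter_f_bounds j_lt lam_gt lam_kap.
have x_gt0 : 0 < iter j (@f R) lam.
  by apply: le_lt_trans x_gt; rewrite divr_ge0 ?ler0n.
have y_gt0 := lt_le_trans x_gt0 xy.
have vertex_mass_cons v : vertex_mass X m (v :: l) = edge_mass X m l v.
  by apply/funext => u; apply: mass_swap.
apply: (spectral_gap_descent (T := fun v => edge_mass X m (v :: l))) gr g_gt0 r_neq0.
- exact: edge_mass_sym.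
- by move=> u; apply: sum_edge_mass m_bal _; rewrite // size_l; lia.
- by move=> v u u'; apply: edge_mass_ge0.
- move=> v u; rewrite (sum_edge_mass _ _ _ m_bal) //= ?size_l; try lia.
  by rewrite vertex_mass_cons.
- move=> u u'.
  rewrite -[RHS](mass_balanced m_gt0 X_complex m_bal) /= ?size_l; try lia.
  apply: eq_bigr => v _; apply: mass_perm.
  by rewrite (perm_catCA [:: u; u'] [:: v] l).
- exact: x_gt0.
- exact: y_gt0.
- by move=> v; rewrite -vertex_mass_cons; apply: IHj => /=; rewrite ?size_l; lia.
Qed.

Local Open Scope classical_set_scope.

Theorem corollary6p1 (R : realType) (V : finType) (n : nat)
    (X : {set {set V}}) (m : {set V} -> R) (lambda kappa : R)
    (n_gt1 : (1 < n)%N)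
    (X_complex : is_complex X) (X_pure : pure n X)
    (m_balanced : balanced_weight n X m)
    (links_connected : forall t : {set V},
       t \in X -> (0 < complex_dim (link X t))%N -> connected (link X t))
    (lambda_le_kappa : lambda <= kappa)
    (lambda_gt : (n%:R - 1) / n%:R < lambda)
    (local_spec :
       (\bigcup_(t in [set t : (n.-1).-tuple V | ordered_simplex X t])
          spec (laplacian_up (link X (supp t)) (link_weight m (supp t)) 0))
         `\` [set 0] `<=` `[lambda, kappa]) :
  forall k : nat, (k <= n.-1)%N ->
    spec (laplacian_up X m k) `\` [set 0] `<=`
      `[(k.+1)%:R * iter (n.-1 - k) (@f R) lambda - k%:R,
        (k.+1)%:R * iter (n.-1 - k) (@f R) kappa - k%:R] /\
    spec (laplacian_down X m k.+1) `\` [set 0] `<=`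
      `[(k.+1)%:R * iter (n.-1 - k) (@f R) lambda - k%:R,
        (k.+1)%:R * iter (n.-1 - k) (@f R) kappa - k%:R].
Proof.
move=> k k_le; have m_gt0 := m_balanced.1.
have local (t : (n.-1).-tuple V) : ordered_simplex X t -> forall r, r != 0 ->
    spec (laplacian_up (link X (supp t)) (link_weight m (supp t)) 0) r ->
    lambda <= r <= kappa.
  move=> tX r r_neq0 r_spec; have := local_spec r; rewrite /= in_itv /=; apply.
  by split; [exists t | apply/eqP].
have gaps (s : k.-tuple V) : spectral_gap (vertex_mass X m s) (edge_mass X m s)
    (iter (n.-1 - k) (@f R) lambda) (iter (n.-1 - k) (@f R) kappa).
  apply: (spectral_gap_of_local_spectrum n_gt1) => //; first exact: leq_subr.
  by rewrite size_tuple subKn.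
have k_lt : (k < n)%N by lia.
have bounds phi r : laplacian_up X m k phi = r *: phi -> phi != 0 -> r != 0 ->
    (k.+1)%:R * iter (n.-1 - k) (@f R) lambda - k%:R <= r <=
    (k.+1)%:R * iter (n.-1 - k) (@f R) kappa - k%:R.
  exact: (garland_bounds m_gt0 X_complex m_balanced k_lt gaps).
split=> r [/specP[psi psi_neq0 psi_r] /eqP r_neq0]; rewrite /= in_itv /=.
  exact: bounds psi_r psi_neq0 r_neq0.
(* [codiff psi] is an eigenvector of the upper Laplacian, and is nonzero
   because [diff] maps it to [r *: psi]. *)
apply: (bounds (codiff X m k.+1 psi)) => //.
  rewrite comp_lfunE; move: psi_r; rewrite comp_lfunE => ->.
  by rewrite linearZ.
apply: contraNneq psi_neq0 => psi0; move: psi_r; rewrite comp_lfunE psi0 linear0.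
by move=> /esym/eqP; rewrite scaler_eq0 (negPf r_neq0).
Qed.
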